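(* For positive integers $d\le n$ and $k\le n$, vectors $\bm a_1,\dots,\bm a_n\in\mathbb{R}^d$ and $\lambda>0$, let $$z_k:=\min_{S\subseteq [n]}\left\{\operatorname{tr}\left(\left(\sum_{i\in S}\bm a_i\bm a_i^{\top}+\lambda \bm I_d\right)^{-1}\right): |S|=k\right\},$$ $$\nu_k^{\mathrm M}:=\min_{\bm x\in[0,1]^n}\left\{\Phi\left(\sum_{i\in[n]}x_i\bm h_i\bm h_i^{\top}\right)+\frac{d-k}{\lambda}: \sum_{i\in[n]}x_i=k\right\},$$ where $\Phi$ and $\bm h_1,\dots,\bm h_n$ are as defined in the context. The following hold. (i) For any $k\in[d]$, $$1\le\frac{z_k}{\nu_k^{\mathrm M}}\le\begin{cases}\min\left\{\frac{d-1}{d-k},\,n-k+1\right\} & \text{if } k\in[d-1];\\ \min\{d,\,n-d+1\} & \text{if } k=d.\end{cases}$$ (ii) If $k\ge d+1$, then there is an instance of the problem (an integer $n\ge k$, vectors $\bm a_1,\dots,\bm a_n\in\mathbb{R}^d$ and a constant $\lambda>0$) for which $\nu_k^{\mathrm M}<0$.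
   Context: $[n]=\{1,\dots,n\}$ and $[s,n]=\{s,\dots,n\}$; the constraint $\bm x\in[0,1]^n$ uses the real unit interval. Let $\bm A\in\mathbb{R}^{d\times n}$ have columns $\bm a_1,\dots,\bm a_n$ and let $\bm C=\bm A^{\top}\bm A+\lambda\bm I_n$, which is positive definite. Let $\bm C=\bm H^{\top}\bm H$ be its Cholesky factorization with $\bm H\in\mathbb{R}^{n\times n}$, and let $\bm h_i\in\mathbb{R}^n$ denote the $i$-th column of $\bm H$. For an $n\times n$ symmetric positive semidefinite matrix $\bm Y$ with eigenvalues $\beta_1\ge\cdots\ge\beta_n\ge0$, $$\Phi(\bm Y):=\sum_{i\in[\iota]}\frac1{\beta_i}+\frac{(k-\iota)^2}{\sum_{i\in[\iota+1,n]}\beta_i},$$ where $0\le\iota\le k-1$ is the unique integer such that $\beta_\iota>\frac{1}{k-\iota}\sum_{i\in[\iota+1,n]}\beta_i\ge\beta_{\iota+1}$, with the convention $\beta_0=\infty$. *)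

(* Defs.v *)
From HB Require Import structures.
From mathcomp Require Import all_boot all_order all_algebra.
From mathcomp Require Import boolp classical_sets reals.

Set Implicit Arguments.
Unset Strict Implicit.
Unset Printing Implicit Defensive.

Import Order.TTheory GRing.Theory Num.Theory.
Local Open Scope classical_set_scope.
Local Open Scope ring_scope.

Definition is_min (R : realType) (E : set R) (m : R) : Prop :=
  E m /\ lbound E m.

(* [is_trig_mx] means lower triangular, so [H] is upper triangular.  A positive
   definite [C] has exactly one factor of this kind, and [xget] selects it. *)
Definition cholesky (R : realType) (n : nat) (C : 'M[R]_n) : 'M[R]_n :=
  xget 0 [set H : 'M[R]_n | [/\ is_trig_mx H^T, forall i, 0 < H i i
                             & H^T *m H = C]].

(* Eigenvalues listed in nonincreasing order, with algebraic multiplicity.  When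
   the characteristic polynomial splits over [R], as it does for a symmetric
   [Y], there is exactly one such list.  The k-th largest eigenvalue is
   [(eigenvalues Y)`_k.-1]. *)
Definition eigenvalues (R : realType) (n : nat) (Y : 'M[R]_n) : seq R :=
  xget [::] [set s : seq R | sorted >=%R s /\
                             char_poly Y = \prod_(b <- s) ('X - b%:P)].

Definition tail_sum (R : realType) (s : seq R) (i : nat) : R :=
  \sum_(i <= j < size s) s`_j.

(* The disjunct [i = 0%N] encodes the convention that the 0-th eigenvalue is
   infinite. *)
Definition Phi_index (R : realType) (k : nat) (s : seq R) : nat :=
  xget 0%N [set i : nat | [/\ (i <= k.-1)%N,
                              i = 0%N \/ tail_sum s i / (k - i)%:R < s`_i.-1
                            & s`_i <= tail_sum s i / (k - i)%:R]].

(* Real-valued: the denominators are positive as soon as [Y] has rank at least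
   [k], which is the case at every point of the feasible set of [relax_values],
   since at least [k] weights are nonzero there. *)
Definition Phi (R : realType) (n k : nat) (Y : 'M[R]_n) : R :=
  let s := eigenvalues Y in
  let i := Phi_index k s in
  \sum_(0 <= j < i) (s`_j)^-1 + (k - i)%:R ^+ 2 / tail_sum s i.

Definition subset_values (R : realType) (d n k : nat) (A : 'M[R]_(d, n))
    (lambda : R) : set R :=
  [set v | exists S : {set 'I_n}, #|S| = k /\
     v = \tr (invmx (\sum_(i in S) col i A *m (col i A)^T + lambda%:M))].

Definition relax_values (R : realType) (d n k : nat) (A : 'M[R]_(d, n))
    (lambda : R) : set R :=
  let H := cholesky (A^T *m A + lambda%:M) in
  [set v | exists x : 'rV[R]_n,
     [/\ forall i, 0 <= x 0 i <= 1, \sum_i x 0 i = k%:R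
       & v = Phi k (\sum_i x 0 i *: (col i H *m (col i H)^T))
             + (d%:R - k%:R) / lambda]].

(* Main.v *)
Require Import Defs.
From HB Require Import structures.
From mathcomp Require Import all_boot all_order all_algebra.
From mathcomp Require Import perm spectral sesquilinear complex.
From mathcomp Require Import ring lra.
From mathcomp Require Import boolp classical_sets reals.
From mathcomp Require Import topology normedtype derive.

(* Write c_S for the principal minor of C on S and e_j for the j-th elementary
   symmetric function of the eigenvalues of Y(x) = sum_i x_i h_i h_i^T.  Since
   Y(x) has the characteristic polynomial of diag(x) C, e_j is the sum of
   x^S c_S over |S| = j.
   - Phi is the minimum of sum_j w_j^2 / beta_j over 0 <= w <= 1, sum w = k.  So
     the relaxation minimizes a linear function over a compact set of tuples
     (x, beta, w, v) with w_j^2 <= v_j beta_j, and its minimum is attained.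
   - tr (sum_S a_i a_i^T + lambda)^-1 = (sum_(i in S) c_(S\i)) / c_S
     + (d - k) / lambda, and at the indicator of S the first term is Phi, whence
     nu <= z.
   - e_(k-1) <= Phi e_k: peel off the large eigenvalues one at a time and bound
     the rest by (m+1) e_(m+1) >= (e_1 - m a) e_m, valid when all beta_j <= a.
     Averaging over S with weights x^S c_S gives a set whose first term is at
     most min(k, n-k+1) Phi.
   - The trace decreases when S grows, so z <= 1/c_i + (d-1)/lambda for every i,
     while Phi >= k / max_i c_i; this gives the factor (d-1)/(d-k). *)

Set Implicit Arguments.
Unset Strict Implicit.
Unset Printing Implicit Defensive.

Import Order.TTheory GRing.Theory Num.Theory.
Import numFieldNormedType.Exports.
Local Open Scope ring_scope.

(** * Elementary symmetric functions of a list *)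

Fixpoint elsym (R : nzRingType) (k : nat) (s : seq R) : R :=
  match k, s with
  | 0, _ => 1
  | _.+1, [::] => 0
  | k'.+1, b :: s' => elsym k s' + b * elsym k' s'
  end.

Lemma elsym0 (R : nzRingType) (s : seq R) : elsym 0 s = 1.
Proof. by case: s. Qed.

Lemma elsym_oversize (R : nzRingType) (k : nat) (s : seq R) :
  (size s < k)%N -> elsym k s = 0.
Proof.
elim: s k => [|b s IHs] [|k] //= ltsk.
by rewrite !IHs ?mulr0 ?addr0 // ltnW.
Qed.

Lemma elsym1 (R : nzRingType) (s : seq R) : elsym 1 s = \sum_(b <- s) b.
Proof.
elim: s => [|b s IHs]; first by rewrite big_nil.
by rewrite big_cons /= -IHs elsym0 mulr1 addrC.
Qed.

(** Vieta's formula; through it [elsym] of the eigenvalues is read off a characteristic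
    polynomial. *)
Lemma coef_prod_XsubC_elsym (R : comNzRingType) (s : seq R) (k : nat) :
  (k <= size s)%N ->
  (\prod_(b <- s) ('X - b%:P))`_(size s - k) = (-1) ^+ k * elsym k s.
Proof.
elim: s k => [|b s IHs] [|k] //= le_ks.
- by rewrite big_nil coef1 mulr1.
- have p_n : (\prod_(c <- s) ('X - c%:P))`_(size s) = 1.
    by have := IHs 0%N; rewrite subn0 expr0 mul1r elsym0; apply.
  rewrite big_cons mulrBl coefB coefXM coefCM /= p_n expr0 mul1r.
  by rewrite nth_default ?mulr0 ?subr0 // size_prod_XsubC.
rewrite big_cons mulrBl coefB coefXM coefCM subSS subn_eq0 (IHs k) //.
move: le_ks; rewrite ltnS leq_eqVlt => /orP[/eqP ->|lt_ks].
  by rewrite leqnn (@elsym_oversize _ _.+1) // exprS; ring.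
by rewrite leqNgt lt_ks /= -subnS IHs // exprS; ring.
Qed.

Section ElsymReal.
Variable R : realFieldType.
Implicit Types (s : seq R) (a b : R).

Lemma elsym_ge0 k s : {in s, forall b, 0 <= b} -> 0 <= elsym k s.
Proof.
elim: s k => [|b s IHs] [|k] //= s_ge0.
have s'_ge0 : {in s, forall b, 0 <= b}.
  by move=> c cs; apply: s_ge0; rewrite inE cs orbT.
by rewrite addr_ge0 ?mulr_ge0 ?IHs // s_ge0 ?mem_head.
Qed.

(** In the product e_1 e_m the squarefree monomials give (m+1) e_(m+1), and the rest is each m-fold
    product times the sum of its own factors, which is at most m a. *)
Lemma elsym_le_succ s a m : {in s, forall b, 0 <= b <= a} ->
  (\sum_(b <- s) b - m%:R * a) * elsym m s <= m.+1%:R * elsym m.+1 s.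
Proof.
elim: s m => [|b s IHs] m s_le.
  rewrite big_nil; case: m => [|m] /=; first by rewrite mul0r subr0 mul0r mulr0.
  by rewrite !mulr0.
have s'_le : {in s, forall b, 0 <= b <= a}.
  by move=> c cs; apply: s_le; rewrite inE cs orbT.
have /andP[b_ge0 ba] := s_le b (mem_head _ _).
have IH := IHs _ s'_le; rewrite big_cons.
set t := \sum_(_ <- _) _ in IH *.
case: m => [|m] /=.
  by have := IH 0%N; rewrite elsym0; lra.
have e_ge0 : 0 <= elsym m s.
  by apply: elsym_ge0 => c /s'_le/andP[].
have := IH m.+1; have := ler_wpM2l b_ge0 (IH m).
(* This is exactly the slack left after adding the induction hypothesis at m+1 and b times the one
   at m. *)
have : 0 <= b * (a - b) * elsym m s.
  by rewrite !mulr_ge0 // subr_ge0.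
rewrite -[m.+2%:R]natr1 -[m.+1%:R]natr1.
set e2 := elsym m.+2 s; set e1 := elsym m.+1 s; set e0 := elsym m s.
nra.
Qed.

(** A new entry b raises a bound p on the ratio of consecutive e_j by at most 1/b: expand the
    product and drop the nonnegative term (1/b + p) e_(m+2). *)
Lemma elsym_le_cons b s p m : 0 < b -> 0 <= p -> {in s, forall c, 0 <= c} ->
  elsym m s <= p * elsym m.+1 s ->
  elsym m.+1 (b :: s) <= (b^-1 + p) * elsym m.+2 (b :: s).
Proof.
move=> b_gt0 p_ge0 s_ge0 le_p /=.
have e2_ge0 : 0 <= elsym m.+2 s by apply: elsym_ge0.
have -> : (b^-1 + p) * (elsym m.+2 s + b * elsym m.+1 s) =
   elsym m.+1 s + b * (p * elsym m.+1 s) + (b^-1 + p) * elsym m.+2 s.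
  by field; lra.
rewrite ler_wpDr ?mulr_ge0 ?addr_ge0 ?invr_ge0 // ?(ltW b_gt0) //.
by rewrite lerD2l ler_pM2l.
Qed.

Lemma elsym_eq0 s i k : (i < k)%N -> (forall j, (i <= j)%N -> s`_j = 0) ->
  elsym k s = 0.
Proof.
elim: s i k => [|b s IHs] i [|k] //= lt_ik s0.
case: i => [|i] in lt_ik s0 *.
  rewrite (s0 0%N isT : b = 0) mul0r addr0 (IHs 0%N) // => j _.
  exact: (s0 j.+1).
have s'0 j : (i <= j)%N -> s`_j = 0 by move=> ij; apply: (s0 j.+1).
by rewrite !(IHs i) ?mulr0 ?addr0 // ltnW.
Qed.

Lemma elsym_gt0_nth k s : {in s, forall b, 0 <= b} ->
  (forall j, (j < k)%N -> 0 < s`_j) -> 0 < elsym k s.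
Proof.
elim: s k => [|b s IHs] [|k] //= s_ge0 s_gt0.
  by have := s_gt0 0%N isT; rewrite ltxx.
have s'_ge0 : {in s, forall c, 0 <= c}.
  by move=> c cs; apply: s_ge0; rewrite inE cs orbT.
rewrite ltr_wpDl ?elsym_ge0 // mulr_gt0 ?(s_gt0 0%N) //.
by apply: IHs => // j; apply: (s_gt0 j.+1).
Qed.

(** With exactly k nonzero entries, e_k is their product, and dividing e_(k-1) by it leaves the sum
    of reciprocals. *)
Lemma elsym_rank k s : (0 < k)%N -> (forall j, (j < k)%N -> 0 < s`_j) ->
  (forall j, (k <= j)%N -> s`_j = 0) ->
  elsym k.-1 s = (\sum_(0 <= j < k) (s`_j)^-1) * elsym k s.
Proof.
elim: s k => [|b s IHs] [|k] //= _ s_gt0 s0.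
  by have := s_gt0 0%N isT; rewrite ltxx.
have b_gt0 : 0 < b := s_gt0 0%N isT.
have s'0 j : (k <= j)%N -> s`_j = 0 by apply: (s0 j.+1).
rewrite (@elsym_eq0 s k k.+1) // add0r big_nat_recl //=.
case: k => [|k] in s_gt0 s0 s'0 *.
  by rewrite big_nil addr0 elsym0 mulr1 mulVf ?gt_eqF.
rewrite (IHs k.+1) //=; last by move=> j; apply: (s_gt0 j.+1).
by field; rewrite gt_eqF.
Qed.

Lemma sorted_nth_le s j l : sorted >=%R s -> {in s, forall b, 0 <= b} ->
  (j <= l)%N -> s`_l <= s`_j.
Proof.
move=> s_sorted s_ge0 jl.
have [ls|sl] := ltnP l (size s); last first.
  rewrite (nth_default _ sl); have [js|/(nth_default _)->//] := ltnP j (size s).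
  by apply/s_ge0/mem_nth.
have tr : transitive (>=%R : rel R) by move=> x y z /= xy yz; apply: le_trans xy.
have := sorted_leq_nth tr (fun x => lexx x) 0 s_sorted.
by apply => //; rewrite inE (leq_ltn_trans jl).
Qed.

(** Induction on [i]: each head entry is peeled off by [elsym_le_cons], and [elsym_le_succ] handles
    the remaining bounded tail. *)
Lemma elsym_le_split a i k s : 0 < a -> (i < k)%N ->
  {in drop i s, forall b, 0 <= b <= a} -> (forall j, (j < i)%N -> 0 < s`_j) ->
  \sum_(b <- drop i s) b = (k - i)%:R * a ->
  elsym k.-1 s <= (\sum_(0 <= j < i) (s`_j)^-1 + (k - i)%:R / a) * elsym k s.
Proof.
move=> a_gt0; elim: i k s => [|i IHi] [|k] // s.
  rewrite drop0 subn0 big_nil add0r => _ s_le _ sum_s /=.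
  have := elsym_le_succ k s_le; rewrite sum_s.
  (* With no head left, e_1 = (k+1) a, so the coefficient in [elsym_le_succ] at m = k is just a. *)
  have -> : k.+1%:R * a - k%:R * a = a by rewrite -natr1; ring.
  by rewrite -ler_pdivlMl // mulrA (mulrC a^-1).
case: s => [|b s] /= ik s_le s_gt0 sum_s.
  by have := s_gt0 0%N isT; rewrite ltxx.
have s'_gt0 j : (j < i)%N -> 0 < s`_j by apply: (s_gt0 j.+1).
case: k => // k in ik sum_s *.
rewrite big_nat_recl //= -addrA; apply: elsym_le_cons (s_gt0 0%N isT) _ _ _.
- rewrite addr_ge0 ?divr_ge0 ?ler0n ?(ltW a_gt0) // big_nat_cond.
  by apply: sumr_ge0 => j /andP[/andP[_ ji] _]; rewrite invr_ge0 ltW ?s'_gt0.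
- move=> c; rewrite -[s](cat_take_drop i) mem_cat => /orP[|/s_le/andP[]//].
  move=> /(nthP 0)[j]; rewrite size_take_min leq_min => /andP[ji _] <-.
  by rewrite nth_take // ltW // s'_gt0.
by rewrite subSS; apply: (IHi k.+1) => //; rewrite -subSS.
Qed.

(* The tangent bound of the perspective function [w ^+ 2 / b], which also holds for
   [b = 0], where [w = 0]. *)
Lemma tangent_le b v w t : 0 <= b -> 0 <= v -> w ^+ 2 <= v * b ->
  2 * t * w - t ^+ 2 * b <= v.
Proof.
rewrite le_eqVlt => /predU1P[<-|b_gt0] v_ge0.
  rewrite mulr0 => w2; have -> : w = 0.
    by apply/eqP; rewrite -sqrf_eq0 eq_le w2 sqr_ge0.
  by rewrite !mulr0 subr0.
move=> w2; rewrite -(ler_pM2r b_gt0); apply: le_trans w2.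
rewrite -subr_ge0.
have -> : w ^+ 2 - (2 * t * w - t ^+ 2 * b) * b = (w - t * b) ^+ 2 by ring.
exact: sqr_ge0.
Qed.

End ElsymReal.

(** * The function Phi on eigenvalue lists *)

Section PhiList.
Variable R : realType.
Implicit Types (s : seq R) (a b : R).

(** [Phi k Y] unfolds to [phi k (eigenvalues Y)], so the analysis can be done on sorted lists. *)
Definition phi k s : R :=
  let i := Phi_index k s in
  \sum_(0 <= j < i) (s`_j)^-1 + (k - i)%:R ^+ 2 / tail_sum s i.

Section Phi.
Variables (k : nat) (s : seq R).
Hypotheses (k_gt0 : (0 < k)%N) (s_sorted : sorted >=%R s).
Hypotheses (s_ge0 : {in s, forall b, 0 <= b}) (elsym_gt0 : 0 < elsym k s).

Lemma nth_ge0 j : 0 <= s`_j.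
Proof.
have [js|/(nth_default _)->//] := ltnP j (size s).
by apply/s_ge0/mem_nth.
Qed.

Lemma leq_size_elsym : (k <= size s)%N.
Proof.
rewrite leqNgt; apply/negP => /elsym_oversize e0.
by move: elsym_gt0; rewrite e0 ltxx.
Qed.

(** A zero tail leaves at most i < k nonzero entries, which would force e_k = 0. *)
Lemma tail_sum_gt0 i : (i < k)%N -> 0 < tail_sum s i.
Proof.
move=> ik; have tail_ge0 : 0 <= tail_sum s i.
  by apply: sumr_ge0 => j _; apply: nth_ge0.
rewrite lt_def tail_ge0 andbT; apply/eqP => tail0.
have s0 j : (i <= j)%N -> s`_j = 0.
  move=> ij; have [js|/(nth_default _)->//] := ltnP j (size s).
  move: tail0; rewrite /tail_sum => /eqP.
  rewrite psumr_eq0; last by move=> l _; apply: nth_ge0.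
  by move=> /allP /(_ j); rewrite mem_index_iota ij js => /(_ isT) /eqP.
by move: elsym_gt0; rewrite (elsym_eq0 ik s0) ltxx.
Qed.

(** A witness is the least i with s_i <= tail_i / (k - i), indices starting at 0. The index k - 1
    qualifies because its tail contains s_(k-1). *)
Lemma Phi_indexP (i := Phi_index k s) :
  [/\ (i <= k.-1)%N, i = 0%N \/ tail_sum s i / (k - i)%:R < s`_i.-1
    & s`_i <= tail_sum s i / (k - i)%:R].
Proof.
pose P i := s`_i <= tail_sum s i / (k - i)%:R.
have tailS j : (j < k)%N -> tail_sum s j = s`_j + tail_sum s j.+1.
  by move=> jk; rewrite /tail_sum big_ltn // (leq_trans jk) ?leq_size_elsym.
have P_last : P k.-1.
  rewrite /P -[in X in (X - _)%N](prednK k_gt0) subSnn divr1.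
  rewrite tailS ?prednK // lerDl; apply: sumr_ge0 => j _; exact: nth_ge0.
have exP : exists i, P i by exists k.-1.
rewrite /i /Phi_index; set E := (X in xget _ X).
suff : exists j, E j by move=> /(xgetPex 0%N).
exists (ex_minn exP); case: ex_minnP => m Pm min_m.
have m_le : (m <= k.-1)%N by apply: min_m.
split=> //; case: m => [|m] in Pm min_m m_le *; [by left|right=> /=].
have mk : (m.+1 < k)%N by rewrite -(prednK k_gt0).
(* Failure at m reads (k - m) s_m > s_m + tail_(m+1); cancelling one s_m gives the strict inequality
   at m + 1. *)
have : ~~ P m by apply/negP => /min_m; rewrite ltnn.
rewrite /P -ltNge tailS ?(ltnW mk) //.
rewrite !ltr_pdivrMr ?ltr0n ?subn_gt0 ?(ltnW mk) // -(subnSK (ltnW mk)) -natr1.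
lra.
Qed.

Lemma Phi_index_lt : (Phi_index k s < k)%N.
Proof. by have [ik _ _] := Phi_indexP; rewrite (leq_ltn_trans ik) // ltn_predL. Qed.

Let i := Phi_index k s.
(** The threshold: entries before index [i] exceed [a], the later ones are at most [a] and sum to (k
    - i) a. *)
Let a := tail_sum s i / (k - i)%:R.

Let subki_gt0 : 0 < (k - i)%:R :> R.
Proof. by rewrite ltr0n subn_gt0 Phi_index_lt. Qed.

Let tailE : tail_sum s i = (k - i)%:R * a.
Proof. by rewrite /a mulrC divfK // gt_eqF. Qed.

Lemma phi_avg_gt0 : 0 < a.
Proof. by rewrite divr_gt0 ?tail_sum_gt0 ?Phi_index_lt. Qed.

Lemma phi_head j : (j < i)%N -> a < s`_j.
Proof.
have [_ + _] := Phi_indexP; rewrite -/i -/a => -[->//|lt_a ji].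
apply: lt_le_trans lt_a (sorted_nth_le s_sorted s_ge0 _).
by rewrite -ltnS prednK // (leq_trans _ ji).
Qed.

Lemma phi_tail j : (i <= j)%N -> s`_j <= a.
Proof.
by have [_ _ le_a] := Phi_indexP => ij; apply: le_trans (sorted_nth_le _ _ ij) _.
Qed.

Lemma phiE : phi k s = \sum_(0 <= j < i) (s`_j)^-1 + (k - i)%:R / a.
Proof.
rewrite /phi -/i tailE; congr (_ + _).
have a_gt0 := phi_avg_gt0.
by field; rewrite !gt_eqF.
Qed.

(* In fact [phi k s] is the minimum of [\sum_j w_j ^+ 2 / s_j] over
   [0 <= w <= 1] with [\sum_j w_j = k]; [v] stands for the quotients. *)
Lemma phi_le (w v : nat -> R) :
  (forall j, (j < size s)%N -> [/\ 0 <= w j <= 1, 0 <= v j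
                                & w j ^+ 2 <= v j * s`_j]) ->
  \sum_(0 <= j < size s) w j = k%:R ->
  phi k s <= \sum_(0 <= j < size s) v j.
Proof.
move=> wv sum_w; have a_gt0 := phi_avg_gt0.
have i_lt : (i < k)%N := Phi_index_lt.
have i_le : (i <= size s)%N := leq_trans (ltnW i_lt) leq_size_elsym.
(* One tangent per index is used: t = 1/a on the tail and t = 1/s_j on the head. *)
have wvt j t : (j < size s)%N -> 2 * t * w j - t ^+ 2 * s`_j <= v j.
  by move=> /wv[_ v0 w2]; apply: tangent_le; rewrite ?nth_ge0.
rewrite phiE (big_cat_nat (leq0n i) i_le (F := v)).
rewrite (big_cat_nat (leq0n i) i_le) /= in sum_w.
set hw := \sum_(0 <= j < i) w j in sum_w.
set tw := \sum_(i <= j < _) w j in sum_w.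
have tail_le : 2 * a^-1 * tw - a^-1 * (k - i)%:R <= \sum_(i <= j < size s) v j.
  apply: le_trans (_ : \sum_(i <= j < size s)
     (2 * a^-1 * w j - a^-1 ^+ 2 * s`_j) <= _); last first.
    by apply: ler_sum_nat => j /andP[_ js]; apply: wvt.
  rewrite sumrB -!mulr_sumr -/(tail_sum s i) tailE -/tw.
  have -> : a^-1 ^+ 2 * ((k - i)%:R * a) = a^-1 * (k - i)%:R.
    by field; rewrite gt_eqF.
  exact: lexx.
(* The tangent equals 1/s - 2 (1 - w)/s; since 1/s <= 1/a and w <= 1, the deficit 1 - w may be
   charged at the common rate 1/a. As the weights sum to k, the charges and the tail bound add up to
   (k - i)/a. *)
have head_le : \sum_(0 <= j < i) ((s`_j)^-1 - 2 * (1 - w j) * a^-1)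
   <= \sum_(0 <= j < i) v j.
  apply: ler_sum_nat => j /andP[_ ji].
  have js : (j < size s)%N := leq_trans ji i_le.
  have lt_a : a < s`_j := phi_head ji.
  have s_gt0 := lt_trans a_gt0 lt_a.
  apply: le_trans (wvt j (s`_j)^-1 js).
  have [/andP[_ w1] _ _] := wv j js.
  have : (s`_j)^-1 <= a^-1 by rewrite lef_pV2 // ltW.
  have -> : (s`_j)^-1 ^+ 2 * s`_j = (s`_j)^-1 by field; rewrite gt_eqF.
  by nra.
apply: le_trans (lerD head_le tail_le).
rewrite sumrB -mulr_suml -mulr_sumr sumrB -/hw big_const_nat subn0.
rewrite iter_addr_0 natrB ?(ltnW i_lt) // -sum_w.
set S := \sum_(_ <= _ < _) _; rewrite -subr_ge0.
by nra.
Qed.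

Lemma phi_attained : exists w v : nat -> R,
  [/\ forall j, [/\ 0 <= w j <= 1, 0 <= v j & w j ^+ 2 <= v j * s`_j],
      \sum_(0 <= j < size s) w j = k%:R
    & \sum_(0 <= j < size s) v j = phi k s].
Proof.
have a_gt0 := phi_avg_gt0; have i_lt : (i < k)%N := Phi_index_lt.
have i_le : (i <= size s)%N := leq_trans (ltnW i_lt) leq_size_elsym.
(* Optimal weights: 1 above the threshold, proportional to the entry below it, with the factor 1/a
   making the total k. *)
exists (fun j => if (j < i)%N then 1 else s`_j / a).
exists (fun j => if (j < i)%N then (s`_j)^-1 else s`_j / a ^+ 2); split.
- move=> j; case: ltnP => [ji|ij].
    have s_gt0 := lt_trans a_gt0 (phi_head ji).
    by rewrite ler01 lexx invr_ge0 nth_ge0 mulVf ?gt_eqF // expr1n lexx.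
  rewrite divr_ge0 ?nth_ge0 ?(ltW a_gt0) //= ler_pdivrMr // mul1r phi_tail //.
  split => //; first by rewrite divr_ge0 ?nth_ge0 ?sqr_ge0.
  by rewrite le_eqVlt; apply/orP; left; apply/eqP; field; rewrite gt_eqF.
- rewrite (big_cat_nat (leq0n i) i_le) //= (eq_big_nat _ _ (F2 := fun=> 1)); last first.
    by move=> j /andP[_ ->].
  rewrite big_const_nat subn0 iter_addr_0.
  rewrite (eq_big_nat _ _ (F2 := fun j => s`_j / a)); last first.
    by move=> j /andP[ij _]; rewrite ltnNge ij.
  rewrite -mulr_suml -/(tail_sum s i) tailE mulfK ?gt_eqF //.
  by rewrite -natrD subnKC // ltnW.
rewrite (big_cat_nat (leq0n i) i_le) //= phiE; congr (_ + _).
  by apply: eq_big_nat => j /andP[_ ->].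
rewrite (eq_big_nat _ _ (F2 := fun j => s`_j / a ^+ 2)); last first.
  by move=> j /andP[ij _]; rewrite ltnNge ij.
by rewrite -mulr_suml -/(tail_sum s i) tailE; field; rewrite gt_eqF.
Qed.

Lemma elsym_le_phi : elsym k.-1 s <= phi k s * elsym k s.
Proof.
rewrite phiE.
have a_gt0 := phi_avg_gt0; have i_lt : (i < k)%N := Phi_index_lt.
have : \sum_(b <- drop i s) b = (k - i)%:R * a.
  rewrite -tailE (big_nth 0) size_drop.
  rewrite [RHS](_ : _ = \sum_(0 + i <= j < size s) s`_j) // big_addn.
  by apply: eq_bigr => j _; rewrite nth_drop addnC.
have : forall j, (j < i)%N -> 0 < s`_j.
  by move=> j /phi_head; apply: lt_trans.
have : {in drop i s, forall b, 0 <= b <= a}.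
  move=> b /(nthP 0)[j _ <-]; rewrite nth_drop nth_ge0 /=.
  by apply: phi_tail; apply: leq_addr.
by move=> s_le s_gt0 sum_s; apply: elsym_le_split.
Qed.

(** The tangent bound with the same t at every index, summed over the optimal weights. *)
Lemma phi_ge t : 2 * t * k%:R - t ^+ 2 * \sum_(b <- s) b <= phi k s.
Proof.
have [w [v [wv <- <-]]] := phi_attained.
rewrite [X in _ - _ * X](big_nth 0) !mulr_sumr -sumrB; apply: ler_sum => j _.
by have [_ v_ge0 w2] := wv j; apply: tangent_le; rewrite ?nth_ge0.
Qed.

(** Exactly k entries are positive, so weight 1 on them and 0 elsewhere is admissible in [phi_le];
    its cost is the sum of reciprocals, which is e_(k-1) / e_k. *)
Lemma phi_rank : (forall j, (k < j)%N -> elsym j s = 0) ->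
  phi k s * elsym k s <= elsym k.-1 s.
Proof.
move=> elsym_eq0k.
have s_gt0 j : (j < k)%N -> 0 < s`_j.
  move=> jk; rewrite lt_def nth_ge0 andbT; apply/eqP => sj0.
  move: elsym_gt0; rewrite (elsym_eq0 jk) ?ltxx // => l jl.
  apply/eqP; rewrite eq_le nth_ge0 andbT.
  by rewrite (le_trans (sorted_nth_le s_sorted s_ge0 jl)) ?sj0.
have sk0 j : (k <= j)%N -> s`_j = 0.
  move=> kj; apply/eqP; rewrite eq_le nth_ge0 andbT.
  apply: le_trans (sorted_nth_le s_sorted s_ge0 kj) _.
  rewrite leNgt; apply/negP => sk_gt0.
  have := elsym_eq0k k.+1 (ltnSn _); apply/eqP; rewrite gt_eqF //.
  apply: elsym_gt0_nth => // l; rewrite ltnS leq_eqVlt => /predU1P[->//|].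
  exact: s_gt0.
rewrite (elsym_rank k_gt0 s_gt0 sk0) ler_pM2r //.
have k_le := leq_size_elsym.
pose v j := if (j < k)%N then (s`_j)^-1 else 0.
pose w j : R := (j < k)%N%:R.
have -> : \sum_(0 <= j < k) (s`_j)^-1 = \sum_(0 <= j < size s) v j.
  rewrite (big_cat_nat (leq0n k) k_le) /= [X in _ + X]big1_seq ?addr0.
    by apply: eq_big_nat => j /andP[_ jk]; rewrite /v jk.
  by move=> j /andP[_]; rewrite mem_index_iota /v => /andP[kj _]; rewrite ltnNge kj.
apply: (@phi_le w).
  move=> j js; rewrite /w /v; case: ltnP => [jk|kj].
    by rewrite ler01 lexx invr_ge0 nth_ge0 mulVf ?gt_eqF ?s_gt0 // expr1n.
  by rewrite lexx ler01 mul0r expr0n.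
rewrite (big_cat_nat (leq0n k) k_le) /= [X in _ + X]big1_seq ?addr0.
  rewrite (eq_big_nat _ _ (F2 := fun=> 1)); last first.
    by move=> j /andP[_ jk]; rewrite /w jk.
  by rewrite big_const_nat subn0 iter_addr_0.
by move=> j /andP[_]; rewrite mem_index_iota /w => /andP[kj _]; rewrite ltnNge kj.
Qed.

End Phi.

End PhiList.

(** * Principal minors *)

(** Multilinearity in the rows; [S] records the rows taken from [A]. *)
Lemma det_add_rows (R : comNzRingType) (n : nat) (A B : 'M[R]_n) :
  \det (A + B) =
  \sum_(S : {set 'I_n}) \det (\matrix_(i, j) if i \in S then A i j else B i j).
Proof.
rewrite exchange_big /=; apply: eq_bigr => s _.
rewrite -mulr_sumr; congr (_ * _).
under eq_bigr do rewrite mxE.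
rewrite bigA_distr; apply: eq_big => // S _.
by apply: eq_bigr => i _; rewrite mxE.
Qed.

Lemma det_scale_rows (R : comNzRingType) (n : nat) (c : 'I_n -> R) (A : 'M[R]_n) :
  \det (\matrix_(i, j) (c i * A i j)) = (\prod_i c i) * \det A.
Proof.
transitivity (\det (diag_mx (\row_i c i) *m A)).
  by rewrite mul_diag_mx; congr (\det _); apply/matrixP => i j; rewrite !mxE.
by rewrite det_mulmx det_diag; congr (_ * _); apply: eq_bigr => i _; rewrite mxE.
Qed.

(* The principal minor of [M] on [S], written as the determinant of a matrix of
   full size to avoid reindexing. *)
Definition pminor (R : comNzRingType) (n : nat) (S : {set 'I_n}) (M : 'M[R]_n) : R :=
  \det (\matrix_(i, j) if i \in S then M i j else (i == j)%:R).

Section Pminor.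
Variables (R : comNzRingType) (n : nat).
Implicit Types (S : {set 'I_n}) (M : 'M[R]_n).

Lemma pminorT M : pminor finset.setT M = \det M.
Proof. by congr (\det _); apply/matrixP => i j; rewrite !mxE inE. Qed.

Lemma pminor0 M : pminor finset.set0 M = 1.
Proof.
by rewrite -[RHS](det1 R n); congr (\det _); apply/matrixP => i j; rewrite !mxE inE.
Qed.

Lemma pminor_rows (c : 'I_n -> R) S M :
  \det (\matrix_(i, j) if i \in S then c i * M i j else c i * (i == j)%:R) =
  (\prod_i c i) * pminor S M.
Proof.
rewrite -det_scale_rows; congr (\det _).
by apply/matrixP => i j; rewrite !mxE; case: ifP.
Qed.

Lemma pminor_diag_mul (x : 'rV[R]_n) S M :
  pminor S (diag_mx x *m M) = (\prod_(i in S) x 0 i) * pminor S M.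
Proof.
rewrite [in RHS]big_mkcond -pminor_rows; congr (\det _).
by apply/matrixP => i j; rewrite mul_diag_mx !mxE; case: ifP; rewrite ?mul1r.
Qed.

Lemma pminorC1 (i : 'I_n) M : pminor (~: [set i]) M = cofactor M i i.
Proof.
rewrite /pminor (expand_det_row _ i) (bigD1 i) //= big1 => [|j ji]; last first.
  by rewrite !mxE !inE eqxx /= eq_sym (negPf ji) mul0r.
rewrite !mxE !inE eqxx /= mul1r addr0 /cofactor; congr (_ * \det _).
by apply/matrixP => r t; rewrite !mxE !inE [lift i r == i]eq_sym (negPf (neq_lift i r)).
Qed.

End Pminor.

(** Expand the determinant of X - M by rows: those in [S] come from -M, the others from X times the
    identity. Pulling -1 or X out of each row leaves the principal minor. *)
Lemma char_poly_pminor (R : comNzRingType) (n : nat) (M : 'M[R]_n) : char_poly M =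
  \sum_(S : {set 'I_n}) ((-1) ^+ #|S| * pminor S M) *: 'X^(n - #|S|).
Proof.
rewrite /char_poly /char_poly_mx addrC det_add_rows.
apply: eq_bigr => S _.
pose c i : {poly R} := if i \in S then -1 else 'X.
transitivity ((\prod_i c i) * pminor S (map_mx polyC M)).
  rewrite -pminor_rows; congr (\det _).
  apply/matrixP => i j; rewrite !mxE /c.
  by case: ifP => _; rewrite ?mulN1r // mulr_natr.
have -> : pminor S (map_mx polyC M) = (pminor S M)%:P.
  rewrite -det_map_mx; congr (\det _); apply/matrixP => i j; rewrite !mxE.
  by case: ifP => // _; rewrite rmorph_nat.
have -> : \prod_i c i = (-1) ^+ #|S| * 'X^(n - #|S|).
  rewrite (bigID (mem S)) /= (eq_bigr (fun=> -1)); last first.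
    by move=> i iS; rewrite /c iS.
  rewrite prodr_const; congr (_ * _).
  rewrite (eq_bigr (fun=> 'X)); last by move=> i iS; rewrite /c (negPf iS).
  have -> : (n - #|S|)%N = #|~: S| by rewrite [RHS]cardsCs finset.setCK card_ord.
  by rewrite prodr_const; congr ('X^_); apply: eq_card => i; rewrite !inE.
by rewrite -mul_polyC rmorphM rmorphXn rmorphN1 /=; ring.
Qed.

Lemma trace_invmx (F : fieldType) (n : nat) (M : 'M[F]_n) : M \in unitmx ->
  \tr (invmx M) = (\sum_i pminor (~: [set i]) M) / \det M.
Proof.
move=> Mu; rewrite /invmx Mu mxtraceZ mulrC; congr (_ / _).
by apply: eq_bigr => i _; rewrite pminorC1 mxE.
Qed.

(** Take determinants in (X - A B) A = A (X - B A) and cancel the nonzero det A. *)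
Lemma char_poly_mulC (F : fieldType) (n : nat) (A B : 'M[F]_n) :
  A \in unitmx -> char_poly (A *m B) = char_poly (B *m A).
Proof.
move=> Au; pose A' := map_mx polyC A; pose B' := map_mx polyC B.
have dA : \det A' != 0.
  by rewrite det_map_mx polyC_eq0 -unitfE -unitmxE.
apply: (mulIf dA); rewrite /char_poly /char_poly_mx -det_mulmx mulrC.
rewrite -det_mulmx; congr (\det _); rewrite !map_mxM -/A' -/B'.
by rewrite mulmxBl mulmxBr mulmxA scalar_mxC.
Qed.

(** Double counting along the bijection between pairs i in S and pairs i not in T, with S = T +
    i. *)
Lemma split_sum_card (R : nzRingType) (n k : nat)
    (F : {set 'I_n} -> 'I_n -> R) :
  \sum_(S : {set 'I_n} | #|S| == k.+1) \sum_(i in S) F (S :\ i) i =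
  \sum_(T : {set 'I_n} | #|T| == k) \sum_(i | i \notin T) F T i.
Proof.
rewrite pair_big_dep /= [RHS]pair_big_dep /=.
rewrite (reindex_onto (fun p => (p.2 |: p.1, p.2)) (fun p => (p.1 :\ p.2, p.2))).
  apply: eq_big => [[T i]|[T i] /=]; rewrite /= ?finset.setU11 ?andbT; last first.
    by move=> /andP[_ /eqP[E]]; rewrite E.
  have [iT|iT] := boolP (i \in T).
    rewrite andbF; apply/negP => /andP[_ /eqP[E]].
    by have := finset.setD11 i (i |: T); rewrite E iT.
  by rewrite finset.setU1K // eqxx cardsU1 iT eqSS.
by move=> [S i] /andP[_ /= iS]; rewrite finset.setD1K.
Qed.

(** * Positive definite matrices *)

Definition posdef (R : numDomainType) (n : nat) (C : 'M[R]_n) : Prop :=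
  C^T = C /\ forall u : 'rV[R]_n, u != 0 -> 0 < (u *m C *m u^T) 0 0.

Section PosDef.
Variable R : rcfType.

(** Induction on the size, passing to the Schur complement [E] of the top left entry. *)
Lemma posdef_cholesky (n : nat) (C : 'M[R]_n) : posdef C ->
  exists H : 'M[R]_n,
    [/\ is_trig_mx H^T, forall i, 0 < H i i & H^T *m H = C].
Proof.
elim: n C => [|n IHn] C.
  move=> _; exists 0; split=> [||]; first by apply/is_trig_mxP => -[].
    by case.
  by apply/matrixP => -[].
rewrite -[n.+1]/(1 + n)%N in C * => -[C_sym C_pos].
pose a := C 0 0; pose v := @ursubmx _ 1 n 1 n C; pose D := @drsubmx _ 1 n 1 n C.
have ulE : @ulsubmx _ 1 n 1 n C = a%:M.
  apply/matrixP => i j; rewrite !ord1 !mxE eqxx mulr1n.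
  by congr (C _ _); apply: val_inj.
have dlE : @dlsubmx _ 1 n 1 n C = v^T by rewrite -{1}C_sym trmx_ursub.
have CE : C = block_mx a%:M v v^T D.
  by rewrite -[LHS](@submxK _ 1 n 1 n C) ulE dlE.
have D_sym : D^T = D by rewrite trmx_drsub C_sym.
have a_gt0 : 0 < a.
  have := C_pos (row_mx 1 0); rewrite CE mul_row_block tr_row_mx mul_row_col.
  rewrite !mul0mx trmx0 mulmx0 !addr0 mul1mx trmx1 mulmx1 mxE eqxx mulr1n; apply.
  apply/eqP => /(congr1 lsubmx); rewrite row_mxKl linear0 => /matrixP /(_ 0 0).
  by rewrite !mxE eqxx => /eqP; rewrite oner_eq0.
pose E := D - a^-1 *: (v^T *m v).
have E_posdef : posdef E.
  split; first by rewrite linearB linearZ /= trmx_mul trmxK D_sym.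
  move=> u u_neq0.
  (* The first coordinate is chosen to cancel the first block of the product, so the form of [C]
     here equals that of [E] at [u]. *)
  have := C_pos (row_mx (- (a^-1 *: (u *m v^T))) u).
  rewrite CE mul_row_block tr_row_mx mul_row_col mul_mx_scalar scalerN scalerA.
  rewrite divff ?gt_eqF // scale1r addNr mul0mx add0r.
  rewrite /E mulmxBr -scalemxAr mulmxA mulNmx -scalemxAl addrC; apply.
  by apply: contra u_neq0 => /eqP /(congr1 rsubmx); rewrite row_mxKr linear0 => /eqP.
have [H [H_trig H_gt0 HE]] := IHn _ E_posdef.
pose r := Num.sqrt a.
have r_gt0 : 0 < r by rewrite sqrtr_gt0.
have rr : r * r = a by rewrite -expr2 sqr_sqrtr // ltW.
exists (block_mx r%:M (r^-1 *: v) 0 H); split.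
- rewrite tr_block_mx is_trig_block_mx // trmx0 eqxx H_trig andbT /=.
  by apply/is_trig_mxP => i j; rewrite !ord1.
- move=> l; rewrite -[l]splitK; case: (split l) => j /=.
    by rewrite block_mxEul !ord1 mxE eqxx.
  by rewrite block_mxEdr.
rewrite tr_block_mx mulmx_block CE !trmx0 !tr_scalar_mx !mul0mx !mulmx0 !addr0.
rewrite HE -scalar_mxM rr mul_scalar_mx scalerA divff ?gt_eqF // scale1r.
rewrite linearZ /= mul_mx_scalar scalerA divff ?gt_eqF // scale1r.
congr block_mx.
rewrite -scalemxAl -scalemxAr scalerA -invfM rr /E addrC subrK //.
Qed.

Lemma posdef_det_gt0 (n : nat) (C : 'M[R]_n) : posdef C -> 0 < \det C.
Proof.
move=> /posdef_cholesky[H [H_trig H_gt0 <-]].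
have dH : 0 < \det H.
  by rewrite -det_tr det_trig // prodr_gt0 // => i _; rewrite mxE.
by rewrite det_mulmx det_tr mulr_gt0.
Qed.

Lemma posdef_unitmx (n : nat) (C : 'M[R]_n) : posdef C -> C \in unitmx.
Proof. by move=> /posdef_det_gt0 ?; rewrite unitmxE unitfE gt_eqF. Qed.

(** A permutation with nonzero contribution fixes every index outside [S], hence preserves [S];
    entries in rows of [S] and columns outside never count. The symmetric form lets positive
    definiteness be applied. *)
Lemma pminor_sym (n : nat) (S : {set 'I_n}) (C : 'M[R]_n) :
  pminor S C = \det (\matrix_(i, j)
    if (i \in S) && (j \in S) then C i j else (i == j)%:R).
Proof.
apply: eq_bigr => s _; congr (_ * _).
have [s_fix|] := boolP [forall i, (i \notin S) ==> (s i == i)].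
  have sS i : i \in S -> s i \in S.
    move=> iS; apply: contraLR iS => siS.
    by move/forallP: s_fix => /(_ (s i)); rewrite siS => /eqP /perm_inj <-.
  by apply: eq_bigr => i _; rewrite !mxE; case: ifPn => //= iS; rewrite sS.
rewrite negb_forall => /existsP[l]; rewrite negb_imply => /andP[lS sl].
by rewrite (bigD1 l) // [RHS](bigD1 l) //= !mxE (negPf lS) /= eq_sym (negPf sl) !mul0r.
Qed.

(** The symmetrized matrix is D C D + D' with complementary coordinate projections, so its form is
    that of [C] at the restriction of [u] to [S] plus the squares outside [S]. *)
Lemma posdef_pminor_gt0 (n : nat) (S : {set 'I_n}) (C : 'M[R]_n) :
  posdef C -> 0 < pminor S C.
Proof.
move=> [C_sym C_pos]; rewrite pminor_sym; apply: posdef_det_gt0; split.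
  apply/matrixP => i j; rewrite !mxE andbC eq_sym.
  by rewrite -{1}C_sym mxE.
move=> u u_neq0; set M := (X in u *m X).
pose w : 'rV[R]_n := \row_i (if i \in S then u 0 i else 0).
have -> : (u *m M *m u^T) 0 0 =
    (w *m C *m w^T) 0 0 + \sum_(i | i \notin S) u 0 i ^+ 2.
  pose D := diag_mx (\row_i (i \in S)%:R : 'rV[R]_n).
  pose D' := diag_mx (\row_i (i \notin S)%:R : 'rV[R]_n).
  have -> : M = D *m C *m D + D'.
    apply/matrixP => i j; rewrite /D mul_mx_diag mul_diag_mx !mxE.
    case: (boolP (i \in S)) => iS; case: (boolP (j \in S)) => jS /=;
      rewrite ?mul1r ?mul0r ?mulr1 ?mulr0 ?mul0rn ?addr0 ?add0r //.
    by case: (i =P j) jS => // <-; rewrite iS.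
  have wE : w = u *m D.
    apply/rowP => i; rewrite /D mul_mx_diag !mxE.
    by case: ifP => _; rewrite ?mulr1 ?mulr0.
  have -> : w^T = D *m u^T by rewrite wE trmx_mul tr_diag_mx.
  rewrite wE mulmxDr mulmxDl !mulmxA mxE; congr (_ + _).
  rewrite mxE [RHS]big_mkcond; apply: eq_bigr => i _.
  by rewrite /D' mul_mx_diag !mxE; case: ifP => _; rewrite ?mulr1 ?mulr0 ?mul0r.
have [w0|w_neq0] := eqVneq w 0; last first.
  by rewrite ltr_wpDr ?C_pos // sumr_ge0 // => i _; apply: sqr_ge0.
rewrite w0 !mul0mx mxE add0r lt_def sumr_ge0 ?andbT; last first.
  by move=> i _; apply: sqr_ge0.
rewrite psumr_neq0; last by move=> i _; apply: sqr_ge0.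
case/rV0Pn: u_neq0 => i ui; apply/hasP; exists i; rewrite ?mem_index_enum //.
rewrite exprn_even_gt0 //= ui andbT; apply: contra ui => iS.
by move/rowP: w0 => /(_ i); rewrite !mxE iS => ->.
Qed.


Lemma posdef_gram (d n : nat) (A : 'M[R]_(d, n)) (l : R) : 0 < l ->
  posdef (A^T *m A + l%:M).
Proof.
move=> l_gt0; split; first by rewrite linearD /= tr_scalar_mx trmx_mul trmxK.
move=> u u_neq0; have sq_sum m (v : 'rV[R]_m) : (v *m v^T) 0 0 = \sum_i v 0 i ^+ 2.
  by rewrite mxE; apply: eq_bigr => i _; rewrite mxE.
rewrite mulmxDr mulmxDl mul_mx_scalar -scalemxAl mulmxA -mulmxA.
have -> : A *m u^T = (u *m A^T)^T by rewrite trmx_mul trmxK.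
rewrite mxE [X in _ + X]mxE !sq_sum ltr_wpDl ?sumr_ge0 // => [i _|].
  exact: sqr_ge0.
rewrite mulr_gt0 // lt_def sumr_ge0 ?andbT => [|i _]; last exact: sqr_ge0.
rewrite psumr_neq0 => [|i _]; last exact: sqr_ge0.
case/rV0Pn: u_neq0 => i ui; apply/hasP; exists i; rewrite ?mem_index_enum //.
by rewrite exprn_even_gt0.
Qed.

(** Sherman-Morrison: the inverses differ by (1 - c) y y^T with y = M^-1 a and c = a^T N^-1 a, so
    the traces differ by (1 - c) |y|^2, and c <= 1. *)
Lemma trace_invmx_rank1 (n : nat) (M : 'M[R]_n) (a : 'cV[R]_n) : posdef M ->
  \tr (invmx (M + a *m a^T)) <= \tr (invmx M).
Proof.
move=> [M_sym M_pos].
have M_ge0 (v : 'rV[R]_n) : 0 <= (v *m M *m v^T) 0 0.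
  have [->|/M_pos/ltW//] := eqVneq v 0.
  by rewrite !mul0mx mxE.
have sqE (b : 'cV[R]_n) (v : 'rV[R]_n) :
    (v *m (b *m b^T) *m v^T) 0 0 = ((v *m b) 0 0) ^+ 2.
  rewrite !mulmxA -mulmxA mxE big_ord1 expr2; congr (_ * _).
  have -> : b^T *m v^T = (v *m b)^T by rewrite trmx_mul.
  by rewrite mxE.
pose N := M + a *m a^T.
have N_posdef : posdef N.
  split; first by rewrite linearD /= M_sym trmx_mul trmxK.
  move=> u /M_pos u_gt0; rewrite mulmxDr mulmxDl mxE sqE.
  by rewrite ltr_wpDr ?sqr_ge0.
have Mu : M \in unitmx by apply: posdef_unitmx.
have Nu : N \in unitmx by apply: posdef_unitmx.
pose y := invmx M *m a; pose u := invmx N *m a.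
pose c := (a^T *m u) 0 0.
have aTu : a^T *m u = c%:M by rewrite [LHS]mx11_scalar.
have aE : a = M *m u + c *: a.
  by rewrite -mul_mx_scalar -aTu (mulmxA a) -mulmxDl -/N /u mulmxA mulmxV // mul1mx.
have uE : u = (1 - c) *: y.
  rewrite /y scalemxAr scalerBl scale1r.
  have -> : a - c *: a = M *m u by rewrite {1}aE addrK.
  by rewrite mulmxA mulVmx // mul1mx.
have c_le1 : c <= 1.
  rewrite leNgt; apply/negP => c_gt1.
  (* If c > 1, this identity makes c nonpositive, a contradiction. *)
  have cE : c = (1 - c) * (y^T *m M *m y^T^T) 0 0.
    rewrite {1}/c uE trmxK -scalemxAr mxE; congr (_ * _).
    by rewrite /y trmx_mul trmx_inv M_sym mulmxKV.
  have : (1 - c) * (y^T *m M *m y^T^T) 0 0 <= 0.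
    by rewrite nmulr_rle0 ?M_ge0 // subr_lt0.
  by rewrite -cE leNgt (lt_trans ltr01 c_gt1).
have diffE : invmx M - invmx N = u *m y^T.
  rewrite /u /y trmx_mul trmx_inv M_sym -!mulmxA (mulmxA a).
  have -> : a *m a^T = N - M by rewrite addrC addKr.
  by rewrite mulmxBl mulmxV // mulmxBr mulmx1 mulmxA mulVmx // mul1mx.
rewrite -subr_ge0 -linearB /= diffE uE -scalemxAl mxtraceZ mxtrace_mulC.
rewrite mulr_ge0 ?subr_ge0 // /mxtrace big_ord1 mxE sumr_ge0 // => i _.
by rewrite mxE -expr2 sqr_ge0.
Qed.

(** Over the complex extension [Y] is Hermitian, so the spectral theorem diagonalizes it with real
    diagonal entries. *)
Lemma symmetric_char_poly_split (n : nat) (Y : 'M[R]_n) : Y^T = Y ->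
  exists s : seq R, char_poly Y = \prod_(b <- s) ('X - b%:P).
Proof.
move=> Y_sym; pose f := real_complex R; pose Yc := map_mx f Y.
have Yc_herm : Yc \is hermsymmx.
  apply: realsym_hermsym.
    by apply/is_hermitianmxP; rewrite expr0 scale1r map_mx_id // map_trmx Y_sym.
  by apply/mxOverP => i j; rewrite mxE; apply/complex_realP; exists (Y i j).
have YcE := orthomx_spectralP (hermitian_normalmx Yc_herm).
have sp_real := hermitian_spectral_diag_real Yc_herm.
exists [seq complex.Re (spectral_diag Yc 0 i) | i <- enum 'I_n].
apply: (map_poly_inj f); rewrite map_char_poly -/Yc {1}YcE.
rewrite -mulmxA char_poly_mulC ?unitmx_inv ?spectral_unit //.
rewrite -mulmxA mulmxV ?spectral_unit // mulmx1.
rewrite char_poly_trig ?diag_mx_is_trig // rmorph_prod /= big_map big_enum /=.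
apply: eq_bigr => l _; rewrite map_polyXsubC mxE eqxx mulr1n.
by congr ('X - _%:P); rewrite /f /= RRe_real //; exact: (mxOverP sp_real).
Qed.

End PosDef.

(** * The trace objective in terms of principal minors of the Gram matrix *)

Section Gram.
Variables (R : rcfType) (d n : nat) (A : 'M[R]_(d, n)) (l : R).
Hypothesis l_gt0 : 0 < l.
Let C := A^T *m A + l%:M.

Lemma sum_col_tr (m p : nat) (B : 'M[R]_(m, p)) (x : 'rV[R]_p) :
  \sum_i x 0 i *: (col i B *m (col i B)^T) = B *m diag_mx x *m B^T.
Proof.
apply/matrixP => r t; rewrite summxE mxE; apply: eq_bigr => i _.
rewrite mul_mx_diag !mxE big_ord1 !mxE; ring.
Qed.

Definition subset_mx (S : {set 'I_n}) : 'M[R]_d :=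
  \sum_(i in S) col i A *m (col i A)^T + l%:M.

Lemma subset_mx_posdef S : posdef (subset_mx S).
Proof.
pose B := \matrix_(i, j) ((j \in S)%:R * A i j).
have -> : subset_mx S = (B^T)^T *m B^T + l%:M; last exact: posdef_gram.
congr (_ + _); rewrite trmxK; apply/matrixP => r t.
rewrite summxE big_mkcond mxE; apply: eq_bigr => i _.
rewrite !mxE; case: ifP => _; last by rewrite !mul0r.
by rewrite big_ord1 !mxE !mul1r.
Qed.

(* With [P] the coordinate projection on [S] and [K = l + P A^T A], the identity
   [(l + A P A^T) A = A K] turns the [d]-dimensional trace into an
   [n]-dimensional one. *)
Lemma trace_subset_mx (S : {set 'I_n}) :
  \tr (invmx (subset_mx S)) =
  (\sum_(i in S) pminor (S :\ i) C) / pminor S C + (d%:R - #|S|%:R) / l.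
Proof.
have c_gt0 := posdef_pminor_gt0 S (posdef_gram A l_gt0).
pose x : 'rV[R]_n := \row_i (i \in S)%:R.
pose K := l%:M + diag_mx x *m (A^T *m A).
pose M := subset_mx S.
have ME : M = A *m diag_mx x *m A^T + l%:M.
  rewrite -sum_col_tr /M /subset_mx big_mkcond; congr (_ + _).
  by apply: eq_bigr => i _; rewrite mxE; case: ifP => _; rewrite ?scale1r ?scale0r.
have Mu : M \in unitmx := posdef_unitmx (subset_mx_posdef S).
(* Rows of [K] in [S] are those of [C], the other rows are [l] times unit rows; [e] collects these
   row factors. *)
pose e i := if i \in S then 1 else l.
have KE T : pminor T K = (\prod_(i in T) e i) * pminor (S :&: T) C.
  rewrite [in RHS]big_mkcond -det_scale_rows; congr (\det _).
  apply/matrixP => i j; rewrite /K mul_diag_mx !mxE !inE /e.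
  case: (boolP (i \in T)) => iT; last by rewrite andbF mul1r.
  rewrite andbT; case: ifP => iS; first by rewrite !mul1r addrC.
  by rewrite mul0r addr0 mulr_natr.
have detK : \det K = (\prod_i e i) * pminor S C.
  by rewrite -pminorT KE finset.setIT; congr (_ * _); apply: eq_bigl => i; rewrite inE.
have e_gt0 i : 0 < e i by rewrite /e; case: ifP.
have Ku : K \in unitmx.
  by rewrite unitmxE unitfE detK mulf_neq0 ?gt_eqF // prodr_gt0.
have trK : \tr (invmx K) =
    (\sum_(i in S) pminor (S :\ i) C) / pminor S C + (n%:R - #|S|%:R) / l.
  have p_gt0 : 0 < \prod_i e i by rewrite prodr_gt0.
  have eC i : \prod_(j in ~: [set i]) e j = (\prod_j e j) / e i.
    rewrite [in RHS](bigD1 i) //= mulrAC divff ?gt_eqF // mul1r.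
    by apply: eq_bigl => j; rewrite !inE.
  rewrite trace_invmx // detK (bigID (mem S)) /= mulrDl; congr (_ + _).
    rewrite (eq_bigr (fun i => (\prod_j e j) * pminor (S :\ i) C)) => [|i iS].
      by rewrite -mulr_sumr invfM mulrACA divff ?mul1r // gt_eqF.
    by rewrite KE eC {2}/e iS divr1 finset.setDE.
  rewrite (eq_bigr (fun=> (\prod_j e j) * pminor S C / l)) => [|i iS].
    rewrite sumr_const; have -> : #|[predC S]| = (n - #|S|)%N.
      by rewrite -{1}[n in RHS]card_ord -(cardC (mem S)) addKn.
    rewrite -[_ *+ (n - _)]mulr_natr natrB; last by rewrite -[n in leqRHS]card_ord max_card.
    by field; rewrite !gt_eqF.
  rewrite KE eC {2}/e (negPf iS) mulrAC; congr (_ * pminor _ _ / _).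
  apply/setP => j; rewrite !inE; case: eqP => [->|]; last by rewrite andbT.
  by rewrite (negPf iS).
have MA : M *m A = A *m K.
  by rewrite ME /K mulmxDl mulmxDr mul_scalar_mx mul_mx_scalar !mulmxA addrC.
(* The Woodbury identity, obtained from M A = A K. *)
have invE : l *: invmx M = 1%:M - A *m invmx K *m diag_mx x *m A^T.
  have -> : A *m invmx K = invmx M *m A.
    by apply: (canRL (mulKmx Mu)); rewrite mulmxA MA mulmxK.
  apply/eqP; rewrite eq_sym subr_eq -(mulVmx Mu) {2}ME mulmxDr mul_mx_scalar.
  by rewrite !mulmxA addrC.
have trE : l * \tr (invmx M) = d%:R - (n%:R - l * \tr (invmx K)).
  rewrite -mxtraceZ invE linearB /= mxtrace1; congr (_ - _).
  rewrite -!mulmxA mxtrace_mulC -!mulmxA.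
  have -> : diag_mx x *m (A^T *m A) = K - l%:M by rewrite /K addrC addKr.
  by rewrite mulmxBr mulVmx // mul_mx_scalar linearB /= mxtrace1 mxtraceZ.
apply: (mulfI (lt0r_neq0 l_gt0)); rewrite trE trK.
by field; rewrite !gt_eqF.
Qed.

End Gram.

(** * Spectrum of the relaxed matrix *)

Lemma eigenvalues_unique (R : realType) (n : nat) (Y : 'M[R]_n) (s : seq R) :
  sorted >=%R s -> char_poly Y = \prod_(b <- s) ('X - b%:P) -> eigenvalues Y = s.
Proof.
move=> s_sorted sE; rewrite /eigenvalues; set E := (X in xget _ X).
have : E (xget [::] E) by apply: (xgetPex [::]); exists s.
move: (xget _ _) => t [t_sorted tE].
apply: (sorted_eq (leT := >=%R)) => //.
- by move=> a b c /= ba ac; apply: le_trans ba.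
- by move=> a b; rewrite andbC; apply: le_anti.
by apply: prod_XsubC_eq; rewrite -tE.
Qed.

Section Relax.
Variables (R : realType) (n : nat) (C : 'M[R]_n).
Hypothesis C_posdef : posdef C.
Let H := cholesky C.

Lemma choleskyP : [/\ is_trig_mx H^T, forall i, 0 < H i i & H^T *m H = C].
Proof. exact: (xgetPex 0 (posdef_cholesky C_posdef)). Qed.

Definition gram_sum (x : 'rV[R]_n) : 'M[R]_n :=
  \sum_i x 0 i *: (col i H *m (col i H)^T).

(** For nonnegative [x] this is e_j of the eigenvalues of [gram_sum x], written as a polynomial in
    the weights. *)
Definition minor_sum (x : 'rV[R]_n) (j : nat) : R :=
  \sum_(S : {set 'I_n} | #|S| == j) (\prod_(i in S) x 0 i) * pminor S C.

(** The matrix is H diag(x) H^T; moving the invertible H to the right end produces H^T H = C. *)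
Lemma char_poly_gram_sum x : char_poly (gram_sum x) = char_poly (diag_mx x *m C).
Proof.
have [H_trig H_gt0 HE] := choleskyP.
have Hu : H \in unitmx.
  rewrite unitmxE unitfE -det_tr det_trig // gt_eqF // prodr_gt0 // => i _.
  by rewrite mxE.
by rewrite /gram_sum sum_col_tr -mulmxA char_poly_mulC // -mulmxA HE.
Qed.

Lemma coef_char_poly_gram_sum x j : (j <= n)%N ->
  (char_poly (gram_sum x))`_(n - j) = (-1) ^+ j * minor_sum x j.
Proof.
move=> jn; rewrite char_poly_gram_sum char_poly_pminor coef_sum.
rewrite /minor_sum mulr_sumr [RHS]big_mkcond; apply: eq_bigr => S _.
rewrite coefZ coefXn pminor_diag_mul.
have Sn : (#|S| <= n)%N by rewrite -[n in leqRHS]card_ord max_card.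
have -> : (n - j == n - #|S|)%N = (#|S| == j) by rewrite eqn_sub2lE // eq_sym.
by case: eqP => [->|_]; rewrite ?mulr1 ?mulr0.
Qed.

Lemma minor_sum_oversize x j : (n < j)%N -> minor_sum x j = 0.
Proof.
move=> nj; rewrite /minor_sum big_pred0 // => S; apply/negbTE.
by rewrite neq_ltn (leq_ltn_trans _ nj) // -[n in leqRHS]card_ord max_card.
Qed.

Lemma eigenvaluesE x (s : seq R) : sorted >=%R s -> size s = n ->
  (forall j, (j <= n)%N -> elsym j s = minor_sum x j) ->
  eigenvalues (gram_sum x) = s.
Proof.
move=> s_sorted sn sE; apply: eigenvalues_unique => //.
apply/polyP => j; have [jn|nj] := leqP j n.
  rewrite -(subKn jn) coef_char_poly_gram_sum ?leq_subr // -sn.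
  by rewrite coef_prod_XsubC_elsym ?leq_subr // sE // sn leq_subr.
by rewrite !nth_default ?size_prod_XsubC ?size_char_poly ?sn.
Qed.

Lemma eigenvaluesP x (s := eigenvalues (gram_sum x)) : (forall i, 0 <= x 0 i) ->
  [/\ sorted >=%R s, size s = n, {in s, forall b, 0 <= b}
    & forall j, elsym j s = minor_sum x j].
Proof.
move=> x_ge0.
have gram_sym : (gram_sum x)^T = gram_sum x.
  by rewrite /gram_sum sum_col_tr !trmx_mul trmxK tr_diag_mx mulmxA.
have [t tE] := symmetric_char_poly_split gram_sym.
have : sorted >=%R s /\ char_poly (gram_sum x) = \prod_(b <- s) ('X - b%:P).
  rewrite /s /eigenvalues; set E := (X in xget _ X).
  suff : exists u, E u by move=> /(xgetPex [::]).
  exists (sort >=%R t); split.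
    by apply: sort_sorted => a b; apply: le_total.
  by rewrite tE; apply: perm_big; rewrite perm_sym perm_sort.
move=> [s_sorted sE]; have sn : size s = n.
  by apply/succn_inj; rewrite -(size_char_poly (gram_sum x)) sE size_prod_XsubC.
have elsymE j : elsym j s = minor_sum x j.
  have [jn|nj] := leqP j n; last by rewrite elsym_oversize ?sn // minor_sum_oversize.
  apply: (mulfI (x := (-1) ^+ j)); first by rewrite signr_eq0.
  rewrite -coef_char_poly_gram_sum // sE.
  by rewrite -coef_prod_XsubC_elsym sn.
split=> // b bs; rewrite leNgt; apply/negP => b_lt0.
(* At a negative b the characteristic polynomial is, up to sign, a sum of nonnegative terms whose
   empty-set term (-b)^n is positive, so b is no root. *)
have : root (char_poly (gram_sum x)) b by rewrite sE root_prod_XsubC.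
rewrite char_poly_gram_sum char_poly_pminor rootE horner_sum.
have -> : \sum_(S : {set 'I_n})
    (((-1) ^+ #|S| * pminor S (diag_mx x *m C)) *: 'X^(n - #|S|)).[b] =
    (-1) ^+ n * \sum_(S : {set 'I_n})
      (\prod_(i in S) x 0 i) * pminor S C * (- b) ^+ (n - #|S|).
  rewrite mulr_sumr; apply: eq_bigr => S _.
  have Sn : (#|S| <= n)%N by rewrite -[n in leqRHS]card_ord max_card.
  rewrite hornerZ hornerXn pminor_diag_mul [(- b) ^+ _]exprNn.
  have -> : (-1) ^+ n = (-1) ^+ #|S| * (-1) ^+ (n - #|S|) :> R.
    by rewrite -exprD subnKC.
  rewrite -[LHS]mulr1 -[X in _ * X = _](sqrr_sign _ (n - #|S|)%N); ring.
rewrite mulf_eq0 signr_eq0 /= => /eqP sum0.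
suff : 0 < \sum_(S : {set 'I_n})
      (\prod_(i in S) x 0 i) * pminor S C * (- b) ^+ (n - #|S|).
  by rewrite sum0 ltxx.
have nb_gt0 : 0 < - b by rewrite oppr_gt0.
rewrite (bigD1 finset.set0) //= big_set0 pminor0 !mul1r ltr_pwDl ?exprn_gt0 //.
apply: sumr_ge0 => S _; rewrite !mulr_ge0 ?prodr_ge0 ?exprn_ge0 ?ltW //.
exact: posdef_pminor_gt0.
Qed.

Definition feasible (k : nat) (x : 'rV[R]_n) : Prop :=
  (forall i, 0 <= x 0 i <= 1) /\ \sum_i x 0 i = k%:R.

(** The relaxed objective without its constant (d - k) / lambda. *)
Definition relax_phi (k : nat) (x : 'rV[R]_n) : R :=
  phi k (eigenvalues (gram_sum x)).

(** Weights at most 1 with total k have at least k nonzero members; a k-set of these gives a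
    positive term. *)
Lemma minor_sum_gt0 k x : feasible k x -> 0 < minor_sum x k.
Proof.
move=> [x01 sum_x].
have x_ge0 i : 0 <= x 0 i by have /andP[] := x01 i.
pose B := [set i | x 0 i != 0]%SET.
have kB : (k <= #|B|)%N.
  rewrite -(ler_nat R) -sum_x (bigID (mem B)) /= [X in _ + X]big1 ?addr0.
    rewrite -sumr_const; apply: ler_sum => i _.
    by have /andP[] := x01 i.
  by move=> i; rewrite inE negbK => /eqP.
pose S := [set i in take k (enum B)]%SET.
have SB i : i \in S -> 0 < x 0 i.
  rewrite inE => /mem_take; rewrite mem_enum inE => xi.
  by rewrite lt_def xi x_ge0.
have Sk : #|S| == k.
  rewrite cardsE (card_uniqP _) ?take_uniq ?enum_uniq // size_takel //.
  by rewrite -cardE.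
rewrite /minor_sum (bigD1 S) //= ltr_pwDl //.
  by rewrite mulr_gt0 ?prodr_gt0 // posdef_pminor_gt0.
apply: sumr_ge0 => T _; rewrite mulr_ge0 ?prodr_ge0 // ltW //.
exact: posdef_pminor_gt0.
Qed.

End Relax.

(** * Existence of a minimizer *)

Section Compactness.
Local Open Scope classical_set_scope.
Variables (R : realType) (T : topologicalType).
Implicit Types f g : T -> R.

Lemma continuous_sum (I : Type) (r : seq I) (P : pred I) (F : I -> T -> R) :
  (forall i, continuous (F i)) -> continuous (fun p => \sum_(i <- r | P i) F i p).
Proof.
move=> F_cont; elim: r => [|i r IHr].
  by under eq_fun do rewrite big_nil; apply: cst_continuous.
under eq_fun do rewrite big_cons; case: (P i) => // p.
by apply: cvgD; [apply: F_cont|apply: IHr].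
Qed.

Lemma continuous_prod (I : Type) (r : seq I) (P : pred I) (F : I -> T -> R) :
  (forall i, continuous (F i)) -> continuous (fun p => \prod_(i <- r | P i) F i p).
Proof.
move=> F_cont; elim: r => [|i r IHr].
  by under eq_fun do rewrite big_nil; apply: cst_continuous.
under eq_fun do rewrite big_cons; case: (P i) => // p.
by apply: cvgM; [apply: F_cont|apply: IHr].
Qed.

Lemma continuous_elsym (I : Type) (r : seq I) (F : I -> T -> R) j :
  (forall i, continuous (F i)) ->
  continuous (fun p => elsym j [seq F i p | i <- r]).
Proof.
move=> F_cont; elim: r j => [|i r IHr] [|j] /=; try exact: cst_continuous.
by move=> p; apply: cvgD; [apply: IHr|apply: cvgM; [apply: F_cont|apply: IHr]].
Qed.

Lemma closed_fun_le f g : continuous f -> continuous g ->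
  closed [set p | f p <= g p].
Proof.
move=> f_cont g_cont.
have -> : [set p | f p <= g p] = (fun p => g p - f p) @^-1` [set y | 0 <= y].
  by apply/seteqP; split => p /=; rewrite subr_ge0.
apply: preimage_closed; last exact: closed_ge.
by move=> p _; apply: cvgB; [apply: g_cont|apply: f_cont].
Qed.

Lemma closed_fun_eq f g : continuous f -> continuous g ->
  closed [set p | f p = g p].
Proof.
move=> f_cont g_cont.
have -> : [set p | f p = g p] = [set p | f p <= g p] `&` [set p | g p <= f p].
  apply/seteqP; split => p /=; first by move=> ->; rewrite lexx.
  by move=> [fg gf]; apply: le_anti; rewrite fg.
by apply: closedI; apply: closed_fun_le.
Qed.

Lemma closed_forall (I : Type) (E : I -> T -> Prop) :
  (forall i, closed [set p | E i p]) -> closed [set p | forall i, E i p].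
Proof.
move=> E_closed.
have -> : [set p | forall i, E i p] = \bigcap_(i in [set: I]) [set p | E i p].
  by apply/seteqP; split => p Ep i; [move=> _|]; apply: Ep.
by apply: closed_bigI => i _; apply: E_closed.
Qed.

End Compactness.

(** * Lifting the relaxation to a compact set *)

Section Attained.
Local Open Scope classical_set_scope.
Variables (R : realType) (n : nat) (C : 'M[R]_n).
Hypothesis C_posdef : posdef C.
Variable k : nat.
Hypotheses (k_gt0 : (0 < k)%N) (k_le : (k <= n)%N).

Local Notation point := ('rV[R]_n * 'rV[R]_n * 'rV[R]_n * 'rV[R]_n)%type.
Let px (p : point) : 'rV[R]_n := p.1.1.1.
Let pb (p : point) : 'rV[R]_n := p.1.1.2.
Let pw (p : point) : 'rV[R]_n := p.1.2.
Let pv (p : point) : 'rV[R]_n := p.2.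

Let box (M : R) : set 'rV[R]_n := [set u | forall i, `[0, M]%classic (u ord0 i)].

Let box_compact M : compact (box M).
Proof. by apply: (@rV_compact _ _ (fun=> `[0, M]%classic)) => i; apply: segment_compact. Qed.

(* Points [(x, b, w, v)] with [b] the eigenvalues of [gram_sum x] and
   [w ^+ 2 / b <= v]; bounding [b] by [M] and [v] by [M'] makes
   the set compact. *)
Let certificates (M M' : R) : set point :=
  (box 1 `*` box M `*` box 1 `*` box M') `&`
  ([set p | \sum_i px p 0 i = k%:R] `&`
  ([set p | \sum_i pw p 0 i = k%:R] `&`
  ([set p | forall i, pw p 0 i ^+ 2 <= pv p 0 i * pb p 0 i] `&`
  ([set p | forall ij : 'I_n * 'I_n, (ij.1 <= ij.2)%N -> pb p 0 ij.2 <= pb p 0 ij.1] `&`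
  [set p | forall j, elsym j [seq pb p 0 i | i <- enum 'I_n] = minor_sum C (px p) j])))).

Let coordinate_cont (f : point -> 'rV[R]_n) i : continuous f ->
  continuous (fun p => f p 0 i).
Proof.
move=> f_cont p.
apply: (@continuous_comp _ _ _ f (fun u : 'rV[R]_n => u 0 i) p (f_cont p)).
exact: coord_continuous.
Qed.

Let fst_cont (U V : topologicalType) (f : point -> U * V) :
  continuous f -> continuous (fun p => (f p).1).
Proof.
by move=> f_cont p; apply: (@continuous_comp _ _ _ f fst p (f_cont p)); apply: cvg_fst.
Qed.

Let snd_cont (U V : topologicalType) (f : point -> U * V) :
  continuous f -> continuous (fun p => (f p).2).
Proof.
by move=> f_cont p; apply: (@continuous_comp _ _ _ f snd p (f_cont p)); apply: cvg_snd.
Qed.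

Let id_cont : continuous (fun p : point => p).
Proof. by move=> p; apply: cvg_id. Qed.

Let px_cont i : continuous (fun p => px p 0 i).
Proof. by apply/coordinate_cont/fst_cont/fst_cont/fst_cont. Qed.

Let pb_cont i : continuous (fun p => pb p 0 i).
Proof. by apply/coordinate_cont/snd_cont/fst_cont/fst_cont. Qed.

Let pw_cont i : continuous (fun p => pw p 0 i).
Proof. by apply/coordinate_cont/snd_cont/fst_cont. Qed.

Let pv_cont i : continuous (fun p => pv p 0 i).
Proof. by apply/coordinate_cont/snd_cont. Qed.

Let certificates_compact M M' : compact (certificates M M').
Proof.
apply: compact_closedI; first by do 3!apply: compact_setX => //.
repeat apply: closedI.
- by apply: closed_fun_eq; [exact: continuous_sum|exact: cst_continuous].
- by apply: closed_fun_eq; [exact: continuous_sum|exact: cst_continuous].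
- apply: closed_forall => i; apply: closed_fun_le => p.
    exact: (cvgM (@pw_cont i p) (@pw_cont i p)).
  by apply: cvgM; [apply: pv_cont|apply: pb_cont].
- apply: closed_forall => -[i j] /=; case: leqP => ij.
    have -> : [set p | true -> pb p 0 j <= pb p 0 i] = [set p | pb p 0 j <= pb p 0 i].
      by apply/seteqP; split => p /=; [apply|].
    exact: closed_fun_le.
  have -> : [set p | false -> pb p 0 j <= pb p 0 i] = setT.
    by apply/seteqP; split.
  exact: closedT.
- apply: closed_forall => j; apply: closed_fun_eq; first exact: continuous_elsym.
  apply: continuous_sum => S p.
  by apply: cvgM; [apply: continuous_prod|apply: cst_continuous].
Qed.

Let nonneg (x : 'rV[R]_n) : feasible k x -> forall i, 0 <= x 0 i.
Proof. by move=> [x01 _] i; have /andP[] := x01 i. Qed.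

(** The trace of [C]: each eigenvalue is at most e_1, the sum of x_i c_i, and the weights are at
    most 1. *)
Let bound : R := \sum_(S : {set 'I_n} | #|S| == 1%N) pminor S C.

(** The optimal weights of [phi_attained] lift [x] without changing its value; each v_i is at most
    their sum, hence at most [M]. *)
Let certificate_intro (x : 'rV[R]_n) M : feasible k x -> relax_phi C k x <= M ->
  exists p, [/\ certificates bound M p, px p = x & \sum_i pv p 0 i = relax_phi C k x].
Proof.
move=> x_feas phi_le_M; have [s_sorted sn s_ge0 sE] :=
  eigenvaluesP C_posdef (nonneg x_feas).
have [x01 sum_x] := x_feas.
rewrite /relax_phi in phi_le_M *; set s := eigenvalues _ in s_sorted sn s_ge0 sE phi_le_M *.
have esk_gt0 : 0 < elsym k s by rewrite sE minor_sum_gt0.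
have [w [v [wv sum_w sum_v]]] := phi_attained k_gt0 s_sorted s_ge0 esk_gt0.
rewrite sn !big_mkord in sum_w sum_v.
exists (x, \row_i s`_i, \row_i w i, \row_i v i).
have rowE (f : nat -> R) : (fun i : 'I_n => (\row_j f j) 0 i) =1 fun i => f i.
  by move=> i; rewrite mxE.
split=> //; last by rewrite -sum_v; apply: eq_bigr => i _; rewrite mxE.
split; [|split; [|split; [|split; [|split]]]] => //=.
- split; [split; [split|]|] => i; rewrite /= in_itv /=.
  + by have := x01 i.
  + rewrite mxE nth_ge0 //=.
    apply: le_trans (_ : elsym 1 s <= _).
      rewrite elsym1 (big_nth 0) sn big_mkord (bigD1 i) //= lerDl.
      by apply: sumr_ge0 => j _; apply: nth_ge0.
    rewrite sE; apply: ler_sum => S _.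
    rewrite ler_piMl //; first by rewrite ltW ?posdef_pminor_gt0.
    by rewrite prodr_ile1 // => j _; apply: x01.
  + by rewrite mxE; have [] := wv i.
  + rewrite mxE; have [_ v_ge0 _] := wv i; rewrite v_ge0 /=.
    apply: le_trans phi_le_M; rewrite -sum_v (bigD1 i) //= lerDl.
    by apply: sumr_ge0 => j _; have [_ ->] := wv j.
- by rewrite /pw /= (eq_bigr _ (fun i _ => rowE w i)).
- by move=> i; rewrite /pw /pv /pb /= !mxE; have [] := wv i.
- by move=> [i j] /= ij; rewrite /pb /= !mxE; apply: sorted_nth_le.
- move=> j; rewrite /px /= -sE; congr (elsym j _).
  rewrite /pb /= (eq_map (rowE (nth 0 s))) map_comp val_enum_ord -sn.
  by rewrite map_nth_iota0 ?take_size.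
Qed.

(** The sorted coordinates [b] have the right elementary symmetric functions, so they are the
    eigenvalues, and [phi_le] bounds the value. *)
Let certificate_elim M M' p : certificates M M' p ->
  feasible k (px p) /\ relax_phi C k (px p) <= \sum_i pv p 0 i.
Proof.
move=> [[[[xbox bbox] wbox] vbox] /= [sum_x [sum_w [wvb [b_sorted bE]]]]].
have x_feas : feasible k (px p).
  by split=> // i; have := xbox i; rewrite /= in_itv.
split=> //; pose t := [seq pb p 0 i | i <- enum 'I_n]; rewrite -/t in bE.
have tn : size t = n by rewrite size_map size_enum_ord.
have t_nth (i : 'I_n) : t`_i = pb p 0 i.
  by rewrite (nth_map i) ?size_enum_ord // nth_ord_enum.
have t_sorted : sorted >=%R t.
  apply/(sortedP 0) => j; rewrite tn => jn.
  by have := b_sorted (Ordinal (ltnW jn), Ordinal jn) (leqnSn j); rewrite -!t_nth.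
rewrite /relax_phi (eigenvaluesE C_posdef t_sorted tn) => [|j _]; last exact: bE.
have t_ge0 : {in t, forall b, 0 <= b}.
  move=> b /mapP[i _ ->]; have := bbox i; rewrite /= in_itv.
  by case/andP.
pose ext (u : 'rV[R]_n) j := if insub j is Some i then u 0 i else 0.
have extE u (i : 'I_n) : ext u i = u 0 i by rewrite /ext valK.
have -> : \sum_i pv p 0 i = \sum_(0 <= j < size t) ext (pv p) j.
  by rewrite tn big_mkord; apply: eq_bigr => i _; rewrite extE.
apply: (phi_le k_gt0 t_sorted t_ge0 _ (w := ext (pw p))).
- by rewrite bE minor_sum_gt0.
- rewrite tn => j jn; rewrite -[j]/(val (Ordinal jn)) !extE t_nth; split.
  + by have := wbox (Ordinal jn); rewrite /= in_itv.
  + by have := vbox (Ordinal jn); rewrite /= in_itv /= => /andP[].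
  + exact: wvb.
- by rewrite tn big_mkord -sum_w; apply: eq_bigr => i _; rewrite extE.
Qed.

Lemma relax_phi_attained : exists x : 'rV[R]_n, feasible k x /\
  forall y, feasible k y -> relax_phi C k x <= relax_phi C k y.
Proof.
(* A feasible point that fixes the bound [M] on the coordinates v. *)
pose x0 : 'rV[R]_n := \row_i (i < k)%N%:R.
have x0_feas : feasible k x0.
  split=> [i|]; first by rewrite mxE; case: ltnP; rewrite lexx ler01.
  under eq_bigr do rewrite mxE.
  rewrite -(big_mkord xpredT (fun i => (i < k)%N%:R)) (big_cat_nat (leq0n k) k_le) /=.
  rewrite [X in _ + X]big1_seq ?addr0 => [|j /andP[_]]; last first.
    by rewrite mem_index_iota => /andP[kj _]; rewrite ltnNge kj.
  rewrite (eq_big_nat _ _ (F2 := fun=> 1)) => [|j /andP[_ ->]//].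
  by rewrite big_const_nat subn0 iter_addr_0.
have [p0 [p0_cert p0x p0v]] := certificate_intro x0_feas (lexx _).
set M := relax_phi C k x0 in p0_cert p0v.
have [|p p_cert p_min] := @compact_EVT_min _ _ (fun p : point => \sum_i pv p 0 i)
  (certificates bound M) (ex_intro _ p0 p0_cert) (@certificates_compact _ _).
  by apply: continuous_subspaceT; apply: continuous_sum.
move: p_cert; rewrite inE => p_cert.
have [x_feas x_le] := certificate_elim p_cert.
exists (px p); split; first exact: x_feas.
move=> y y_feas; apply: (le_trans x_le).
(* Points with value above [M] lose already to x0; the others lift to a certificate. *)
have [yM|/ltW My] := leP (relax_phi C k y) M; last first.
  by apply: le_trans My; rewrite -p0v; apply: p_min; rewrite inE.
have [q [q_cert _ <-]] := certificate_intro y_feas yM.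
by apply: p_min; rewrite inE.
Qed.

End Attained.

(** * Rounding *)

Lemma exists_card_superset (T : finType) (B : {set T}) (k : nat) :
  (#|B| <= k <= #|T|)%N -> exists2 S : {set T}, B \subset S & #|S| = k.
Proof.
move=> /andP[]; elim: k => [|k IHk].
  by rewrite leqn0 => /eqP B0 _; exists B.
rewrite leq_eqVlt => /predU1P[Bk _|Bk kT]; first by exists B.
have [S BS Sk] := IHk Bk (ltnW kT).
have : (0 < #|~: S|)%N by rewrite cardsCs finset.setCK Sk subn_gt0.
case/card_gt0P => i; rewrite inE => iS; exists (i |: S)%SET.
  exact: (fintype.subset_trans BS (finset.subsetUr _ _)).
by rewrite cardsU1 iS Sk.
Qed.

Section Rounding.
Variables (R : realType) (n : nat) (C : 'M[R]_n) (k : nat).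
Hypotheses (C_posdef : posdef C) (k_gt0 : (0 < k)%N).

(** By Cramer's rule, the trace of the inverse of the principal submatrix of [C] on [S]. *)
Definition inv_trace (S : {set 'I_n}) : R :=
  (\sum_(i in S) pminor (S :\ i) C) / pminor S C.

Let pm_gt0 S : 0 < pminor S C.
Proof. exact: posdef_pminor_gt0. Qed.

Let feasible_ge0 (x : 'rV[R]_n) : feasible k x -> forall i, 0 <= x 0 i.
Proof. by move=> [x01 _] i; have /andP[] := x01 i. Qed.

(** At the indicator of [S] only subsets of [S] survive in [minor_sum]: e_k is the minor on [S],
    e_(k-1) the sum of the minors on S \ i, and higher e_j vanish. Hence [phi_rank] applies. *)
Lemma relax_phi_indicator (S : {set 'I_n}) : #|S| = k ->
  exists2 x : 'rV[R]_n, feasible k x & relax_phi C k x <= inv_trace S.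
Proof.
move=> Sk; pose x : 'rV[R]_n := \row_i (i \in S)%:R.
have x_feas : feasible k x.
  split=> [i|]; first by rewrite mxE; case: (i \in S); rewrite lexx ler01.
  rewrite -Sk -sum1_card [in RHS]big_mkcond natr_sum; apply: eq_bigr => i _.
  by rewrite mxE; case: ifP.
exists x => //.
have xT (T : {set 'I_n}) : \prod_(i in T) x 0 i = (T \subset S)%:R.
  have [TS|/subsetPn[i iT iS]] := boolP (T \subset S).
    by rewrite big1 // => i /(fintype.subsetP TS) iS; rewrite mxE iS.
  by rewrite (bigD1 i) //= mxE (negPf iS) mul0r.
have msE j : minor_sum C x j =
    \sum_(T : {set 'I_n} | (#|T| == j) && (T \subset S)) pminor T C.
  rewrite /minor_sum [RHS]big_mkcondr; apply: eq_bigr => T _.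
  by rewrite xT; case: ifP; rewrite ?mul1r ?mul0r.
have msk : minor_sum C x k = pminor S C.
  rewrite msE (big_pred1 S) // => T; rewrite /= -Sk.
  apply/andP/eqP => [[/eqP TS sTS]|->]; last by rewrite eqxx.
  by apply/eqP; rewrite eqEcard sTS TS leqnn.
have msk1 : minor_sum C x k.-1 = \sum_(i in S) pminor (S :\ i) C.
  rewrite msE; transitivity (\sum_(T in [set S :\ i | i in S]%SET) pminor T C); last first.
    rewrite big_imset //= => i j iS jS /finset.setP /(_ i).
    by rewrite !inE eqxx iS /= andbT => /esym /negbFE /eqP.
  apply: eq_bigl => T; apply/andP/imsetP => [[/eqP Tk TS]|[i iS ->]].
    have : T \proper S by rewrite properEcard TS Tk Sk ltn_predL.
    case/properP => _ [i iS iT]; exists i => //; apply/eqP.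
    by rewrite eqEcard subsetD1 TS iT /= Tk -Sk (cardsD1 i S) iS.
  by rewrite subD1set -Sk (cardsD1 i S) iS.
have [s_sorted sn s_ge0 sE] := eigenvaluesP C_posdef (feasible_ge0 x_feas).
rewrite /inv_trace ler_pdivlMr // -msk -msk1 -!sE.
apply: phi_rank => //; first by rewrite sE msk.
move=> j kj; rewrite sE msE big_pred0 // => T.
apply/andP => -[/eqP Tj /subset_leq_card].
by rewrite Tj Sk leqNgt kj.
Qed.

(* Averages [inv_trace S] over [k]-sets with weights
   [(\prod_(i in S) x 0 i) * pminor S C], as in volume sampling. *)
Lemma inv_trace_le_relax_phi (x : 'rV[R]_n) (r B : R) : feasible k x ->
  (forall S : {set 'I_n}, #|S| = k -> r <= inv_trace S) ->
  (forall T : {set 'I_n}, #|T| = k.-1 -> \sum_(i | i \notin T) x 0 i <= B) ->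
  0 <= B -> r <= B * relax_phi C k x.
Proof.
move=> x_feas r_le B_ge B_ge0; have x_ge0 := feasible_ge0 x_feas.
have [s_sorted sn s_ge0 sE] := eigenvaluesP C_posdef x_ge0.
have ek_gt0 := minor_sum_gt0 C_posdef x_feas.
rewrite -(ler_pM2r ek_gt0).
have le_e : minor_sum C x k.-1 <= relax_phi C k x * minor_sum C x k.
  by rewrite -!sE; apply: elsym_le_phi => //; rewrite sE.
rewrite -mulrA; apply: le_trans (ler_wpM2l B_ge0 le_e).
rewrite /minor_sum !mulr_sumr.
apply: le_trans (_ : \sum_(S : {set 'I_n} | #|S| == k)
    \sum_(i in S) (\prod_(j in S :\ i) x 0 j) * x 0 i * pminor (S :\ i) C <= _).
  apply: ler_sum => S /eqP Sk; rewrite mulrCA.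
  have -> : \sum_(i in S) (\prod_(j in S :\ i) x 0 j) * x 0 i * pminor (S :\ i) C
      = (\prod_(j in S) x 0 j) * \sum_(i in S) pminor (S :\ i) C.
    rewrite mulr_sumr; apply: eq_bigr => i iS.
    by rewrite [in RHS](big_setD1 i iS) /= [x 0 i * _]mulrC.
  by rewrite ler_wpM2l ?prodr_ge0 // -ler_pdivlMr // r_le.
rewrite -{1}(prednK k_gt0).
(* Regrouped by T = S \ i, the inner sum is that of x_i over i outside T, which is at most [B]. *)
rewrite (split_sum_card _ (fun T i => (\prod_(j in T) x 0 j) * x 0 i * pminor T C)).
apply: ler_sum => T /eqP Tk; rewrite -mulr_suml -mulr_sumr mulrC.
rewrite [leRHS]mulrA [B * _]mulrC mulrC ler_wpM2r //; first exact: ltW.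
by rewrite ler_wpM2l ?prodr_ge0 // B_ge.
Qed.

(** The eigenvalues sum to at most k c, so [phi_ge] with t = 1/c gives 2k/c - k/c. *)
Lemma relax_phi_ge (x : 'rV[R]_n) (c : R) : feasible k x -> 0 < c ->
  (forall i, pminor [set i]%SET C <= c) -> k%:R / c <= relax_phi C k x.
Proof.
move=> x_feas c_gt0 c_ge; have x_ge0 := feasible_ge0 x_feas.
have [s_sorted sn s_ge0 sE] := eigenvaluesP C_posdef x_ge0.
have sum_s : \sum_(b <- eigenvalues (gram_sum C x)) b <= k%:R * c.
  rewrite -elsym1 sE /minor_sum.
  apply: le_trans (_ : \sum_(S : {set 'I_n} | #|S| == 1%N)
      \sum_(i in S) x 0 i * pminor [set i]%SET C <= _).
    by apply: ler_sum => S /cards1P[i ->]; rewrite !big_set1.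
  rewrite (split_sum_card 0 (fun _ i => x 0 i * pminor [set i]%SET C)).
  rewrite (big_pred1 finset.set0) => [|S]; last by rewrite /= cards_eq0.
  case: x_feas => _ <-; rewrite mulr_suml big_mkcond; apply: ler_sum => i _.
  by rewrite inE /= ler_wpM2l.
have : 2 * c^-1 * k%:R - c^-1 ^+ 2 * \sum_(b <- eigenvalues (gram_sum C x)) b
    <= relax_phi C k x.
  by apply: phi_ge => //; rewrite sE minor_sum_gt0.
apply: le_trans; apply: le_trans (_ : 2 * c^-1 * k%:R - c^-1 ^+ 2 * (k%:R * c) <= _).
  by rewrite le_eqVlt; apply/orP; left; apply/eqP; field; rewrite gt_eqF.
by rewrite lerD2l lerN2 ler_wpM2l ?sqr_ge0.
Qed.

End Rounding.

(** * Monotonicity of the trace, attained minima and the two claims *)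

Lemma trace_subset_mx_mono (R : rcfType) (d n : nat) (A : 'M[R]_(d, n)) (l : R)
    (T S : {set 'I_n}) : 0 < l -> T \subset S ->
  \tr (invmx (subset_mx A l S)) <= \tr (invmx (subset_mx A l T)).
Proof.
move=> l_gt0; elim: {S}_.+1 {-2}S (ltnSn #|S|) => // m IHm S Sm TS.
have [->//|] := eqVneq T S.
rewrite eqEproper TS negbK => /properP[_ [i iS iT]].
apply: le_trans (IHm (S :\ i) _ _); last first.
- by rewrite subsetD1 TS iT.
- by rewrite (cardsD1 i S) iS in Sm.
have -> : subset_mx A l S = subset_mx A l (S :\ i) + col i A *m (col i A)^T.
  by rewrite /subset_mx (big_setD1 i iS) /= -addrA addrC.
exact: trace_invmx_rank1 (subset_mx_posdef _ l_gt0 _).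
Qed.

Lemma relax_values_attained (R : realType) (d n k : nat) (A : 'M[R]_(d, n)) (l : R)
    (C := A^T *m A + l%:M) : 0 < l -> (0 < k <= n)%N ->
  exists2 x : 'rV[R]_n, feasible k x &
    (forall y, feasible k y -> relax_phi C k x <= relax_phi C k y) /\
    is_min (relax_values k A l) (relax_phi C k x + (d%:R - k%:R) / l).
Proof.
move=> l_gt0 /andP[k_gt0 kn]; have C_posdef : posdef C := posdef_gram A l_gt0.
have [x [x_feas x_min]] := relax_phi_attained C_posdef k_gt0 kn.
exists x => //; split=> //; split; first by exists x; case: x_feas.
by move=> _ [y [y01 sum_y ->]]; rewrite lerD2r; apply: x_min.
Qed.

Lemma inv_trace_min (R : realType) (n k : nat) (C : 'M[R]_n) : (k <= n)%N ->
  exists2 S : {set 'I_n}, #|S| = k &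
    forall T : {set 'I_n}, #|T| = k -> inv_trace C S <= inv_trace C T.
Proof.
move=> kn; have [S0 _ S0k] : exists2 S : {set 'I_n}, finset.set0 \subset S & #|S| = k.
  by apply: exists_card_superset; rewrite cards0 card_ord.
have [S /eqP Sk S_min] :=
    @arg_minP _ _ _ S0 (fun T => #|T| == k) (inv_trace C) (introT eqP S0k).
by exists S => // T /eqP; apply: S_min.
Qed.

Lemma relax_ratio_bounds (R : realType) (d n k : nat) (A : 'M[R]_(d, n)) (lambda : R) :
     (0 < d)%N -> (d <= n)%N -> (0 < k)%N -> (k <= d)%N -> 0 < lambda ->
     exists z nu : R,
       [/\ is_min (subset_values k A lambda) z,
           is_min (relax_values k A lambda) nu,
           1 <= z / nu
         & z / nu <=
           if (k < d)%N
           then Num.min ((d%:R - 1) / (d%:R - k%:R)) (n%:R - k%:R + 1)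
           else Num.min d%:R (n%:R - d%:R + 1)].
Proof.
move=> d_gt0 dn k_gt0 kd l_gt0; have kn := leq_trans kd dn.
pose C := A^T *m A + lambda%:M; have C_posdef : posdef C := posdef_gram A l_gt0.
have pm_gt0 S : 0 < pminor S C := posdef_pminor_gt0 S C_posdef.
have valueE (S : {set 'I_n}) : #|S| = k -> \tr (invmx (subset_mx A lambda S)) =
    inv_trace C S + (d%:R - k%:R) / lambda.
  by move=> Sk; rewrite trace_subset_mx // Sk.
have [S Sk S_min] := inv_trace_min C kn.
have [|x x_feas [x_min nu_min]] := @relax_values_attained R d n k A lambda l_gt0.
  by rewrite k_gt0.
set f := relax_phi _ k x in x_min nu_min.
set P := (_ - _) / _ in valueE nu_min.
have P_ge0 : 0 <= P by rewrite divr_ge0 ?subr_ge0 ?ler_nat // ltW.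
exists (inv_trace C S + P), (f + P).
have n_gt0 : (0 < n)%N := leq_trans d_gt0 dn.
(* The index of a largest diagonal entry c of [C]. *)
have [i0 _ i0_max] :=
  @arg_maxP _ _ _ (Ordinal n_gt0) xpredT (fun i => pminor [set i] C) isT.
set c := pminor [set i0] C in i0_max; have c_gt0 : 0 < c := pm_gt0 _.
have kf : k%:R / c <= f by apply: relax_phi_ge => // i; apply: i0_max.
have f_gt0 : 0 < f by apply: lt_le_trans kf; rewrite divr_gt0 ?ltr0n.
have nu_gt0 : 0 < f + P by rewrite ltr_pwDl.
have f_le : f <= inv_trace C S.
  have [y y_feas] := relax_phi_indicator C_posdef k_gt0 Sk.
  by apply: le_trans; apply: x_min.
have x01 : forall i, 0 <= x 0 i <= 1 by case: x_feas.
have round B : 0 <= B ->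
    (forall T : {set 'I_n}, #|T| = k.-1 -> \sum_(i | i \notin T) x 0 i <= B) ->
    inv_trace C S <= B * f.
  by move=> B_ge0 B_ge; apply: inv_trace_le_relax_phi.
(* Here [B] is the total weight k. *)
have round_k : inv_trace C S <= k%:R * f.
  apply: round => // T _; case: x_feas => _ <-.
  by rewrite [leRHS](bigID (mem T)) /= lerDr sumr_ge0 // => i _; case/andP: (x01 i).
(* The complement of a (k-1)-set has n - k + 1 indices, each of weight at most 1. *)
have round_n : inv_trace C S <= (n%:R - k%:R + 1) * f.
  have nkE : n%:R - k%:R + 1 = (n - k.-1)%:R :> R.
    rewrite natrB; last exact: leq_trans (leq_pred _) kn.
    by rewrite -{1}(prednK k_gt0) -natr1; ring.
  rewrite nkE; apply: round => // T Tk.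
  have -> : (n - k.-1)%:R = \sum_(i | i \notin T) 1 :> R.
    rewrite sumr_const -Tk; congr (_%:R).
    by rewrite -{1}[n in LHS]card_ord -(cardC (mem T)) addKn.
  by apply: ler_sum => i _; case/andP: (x01 i).
have nk_ge1 : 1 <= n%:R - k%:R + 1 :> R by rewrite lerDr subr_ge0 ler_nat.
have le_n : inv_trace C S + P <= (n%:R - k%:R + 1) * (f + P).
  by rewrite mulrDr lerD // ler_peMl.
split=> //.
- split; first by exists S; rewrite -valueE.
  by move=> _ [T [Tk ->]]; rewrite -/(subset_mx A lambda T) valueE // lerD2r S_min.
- by rewrite ler_pdivlMr // mul1r lerD2r.
case: ltngtP kd => // [kd _|kd _].
  rewrite le_min !ler_pdivrMr // le_n andbT.
  (* The optimum is at most the trace at a k-set containing i0, hence at most the trace at i0 alone,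
     which is 1/c + (d - 1)/lambda. *)
  have [S' i0S' S'k] : exists2 S : {set 'I_n}, [set i0] \subset S & #|S| = k.
    by apply: exists_card_superset; rewrite cards1 card_ord k_gt0.
  have le_c : inv_trace C S + P <= c^-1 + (d%:R - 1) / lambda.
    apply: le_trans (_ : inv_trace C S' + P <= _); first by rewrite lerD2r S_min.
    rewrite -valueE //; apply: le_trans (trace_subset_mx_mono _ l_gt0 i0S') _.
    rewrite trace_subset_mx // cards1 big_set1 finset.setDv pminor0 -/C -/c.
    by rewrite mul1r.
  apply: le_trans le_c _; have dk_gt0 : 0 < d%:R - k%:R :> R by rewrite subr_gt0 ltr_nat.
  (* The factor (d-1)/(d-k) turns (d-k)/lambda into exactly (d-1)/lambda, and being at least 1 it
     preserves 1/c <= f. *)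
  rewrite mulrDr; apply: lerD; last first.
    by rewrite /P mulrA divfK ?gt_eqF.
  have cf : c^-1 <= f.
    by apply: le_trans kf; rewrite ler_peMl ?ler1n // invr_ge0 ltW.
  apply: le_trans cf _; rewrite ler_peMl ?(ltW f_gt0) // ler_pdivlMr // mul1r.
  by rewrite lerD2l lerN2 ler1n.
have P0 : P = 0 by rewrite /P kd subrr mul0r.
rewrite le_min !ler_pdivrMr // -{2}kd le_n andbT P0 !addr0 -kd.
exact: round_k.
Qed.

(* With [n = k + 1] and [A] equal to [n] times a truncated identity matrix, the
   uniform point already has a negative value. *)
Lemma relax_negative (R : realType) (d k : nat) : (0 < d)%N -> (d + 1 <= k)%N ->
     exists (n : nat) (A : 'M[R]_(d, n)) (lambda nu : R),
       [/\ (k <= n)%N, 0 < lambda,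
           is_min (relax_values k A lambda) nu
         & nu < 0].
Proof.
move=> d_gt0; rewrite addn1 => dk; have k_gt0 : (0 < k)%N := leq_ltn_trans (leq0n d) dk.
pose n := k.+1.
pose A : 'M[R]_(d, n) := \matrix_(i, j) (n%:R *+ (i == j :> nat)).
have [|x x_feas [x_min nu_min]] := @relax_values_attained R d n k A 1 ltr01.
  by rewrite k_gt0 leqnSn.
exists n, A, 1, (relax_phi (A^T *m A + 1%:M) k x + (d%:R - k%:R) / 1).
split=> //.
set C := A^T *m A + 1%:M in x_min *.
have C_posdef : posdef C := posdef_gram A ltr01.
(* The diagonal of [C], in nonincreasing order. *)
pose c j : R := if (j < d)%N then n%:R ^+ 2 + 1 else 1.
have CE : C = diag_mx (\row_j c j).
  apply/matrixP => i j; rewrite !mxE /c.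
  have AE r (l : 'I_n) : A r l = n%:R *+ (r == l :> nat) by rewrite mxE.
  under eq_bigr do rewrite mxE !AE.
  case: (ltnP i d) => id.
    rewrite (bigD1 (Ordinal id)) //= big1 => [|r ri]; last first.
      have -> : (r == i :> nat) = false by apply: contra_neqF ri => /eqP E; apply: val_inj.
      by rewrite mul0r.
    rewrite eqxx addr0 -(inj_eq val_inj) /=.
    by case: eqP => _; rewrite ?mulr1n ?mulr0n ?mulr0 ?addr0 ?expr2.
  rewrite big1 ?add0r // => r _.
  have -> : (r == i :> nat) = false by rewrite ltn_eqF // (leq_trans (ltn_ord r)).
  by rewrite mul0r.
pose y : 'rV[R]_n := const_mx (k%:R / n%:R).
have n_gt0 : 0 < n%:R :> R by rewrite ltr0n.
have q_gt0 : 0 < k%:R / n%:R :> R by rewrite divr_gt0 ?ltr0n.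
have y_feas : feasible k y.
  split=> [i|]; first by rewrite mxE ltW //= ler_pdivrMr // mul1r ler_nat leqnSn.
  under eq_bigr do rewrite mxE.
  by rewrite sumr_const card_ord -[_ *+ n]mulr_natr divfK // gt_eqF.
have c_gt0 j : 0 < c j by rewrite /c; case: ifP => // _; rewrite ltr_wpDl ?sqr_ge0.
pose t := mkseq (fun j => k%:R / n%:R * c j) n.
have t_nth j : (j < n)%N -> t`_j = k%:R / n%:R * c j by move=> jn; rewrite nth_mkseq.
have t_sorted : sorted >=%R t.
  apply/(sortedP 0) => j; rewrite size_mkseq => jn.
  rewrite !t_nth ?(ltnW jn) //= ler_pM2l // /c.
  case: (ltnP j.+1 d) => jd; first by rewrite (ltnW jd).
  by case: ifP => // _; rewrite lerDr sqr_ge0.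
have t_ge0 : {in t, forall b, 0 <= b}.
  by move=> b /mapP[j _ ->]; rewrite mulr_ge0 ?ltW.
have tE : eigenvalues (gram_sum C y) = t.
  apply: eigenvalues_unique => //; rewrite char_poly_gram_sum //.
  have -> : diag_mx y *m C = diag_mx (\row_j (k%:R / n%:R * c j)).
    by rewrite CE mul_diag_mx; apply/matrixP => i j; rewrite !mxE mulrnAr.
  rewrite char_poly_trig ?diag_mx_is_trig // big_map -[iota 0 n]/(index_iota 0 n).
  by rewrite big_mkord; apply: eq_bigr => j _; rewrite !mxE eqxx mulr1n.
apply: le_lt_trans (_ : relax_phi C k y + (d%:R - k%:R) / 1 < 0).
  by rewrite lerD2r x_min.
rewrite divr1 -opprB subr_lt0.
have dn : (d <= n)%N := leqW (ltnW dk).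
have k1 : 0 < k%:R :> R by rewrite ltr0n.
have d1 : 1 <= d%:R :> R by rewrite ler1n.
have dk1 : d%:R + 1 <= k%:R :> R by rewrite natr1 ler_nat.
have nE : n%:R = k%:R + 1 :> R by rewrite natr1.
have nd_gt0 : 0 < n%:R - d%:R :> R by rewrite subr_gt0 ltr_nat ltnS ltnW.
have split_sum (u1 u2 : R) :
    \sum_(0 <= j < n) (if (j < d)%N then u1 else u2) =
    d%:R * u1 + (n%:R - d%:R) * u2.
  rewrite (big_cat_nat (leq0n d) dn) /=; congr (_ + _).
    rewrite (eq_big_nat _ _ (F2 := fun=> u1)) => [|j /andP[_ ->]//].
    by rewrite big_const_nat subn0 iter_addr_0 mulr_natl.
  rewrite (eq_big_nat _ _ (F2 := fun=> u2)) => [|j /andP[dj _]]; last first.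
    by rewrite ltnNge dj.
  by rewrite big_const_nat iter_addr_0 -natrB // mulr_natl.
(* Test weights for [phi_le]: 1 on the d large eigenvalues, the remaining k - d spread evenly over
   the n - d small ones. *)
pose r : R := (k%:R - d%:R) / (n%:R - d%:R).
have r_ge0 : 0 <= r by apply: divr_ge0; lra.
have r_le1 : r <= 1 by rewrite ler_pdivrMr // mul1r; lra.
pose q : R := k%:R / n%:R.
pose w j : R := if (j < d)%N then 1 else r.
pose v j : R := if (j < d)%N then (q * (n%:R ^+ 2 + 1))^-1 else r ^+ 2 / q.
have phi_le_v : relax_phi C k y <= \sum_(0 <= j < n) v j.
  rewrite /relax_phi tE -(size_mkseq (fun j => k%:R / n%:R * c j) n).
  apply: (phi_le k_gt0 t_sorted t_ge0 _ (w := w)).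
  - apply: elsym_gt0_nth => // j jk; have jn : (j < n)%N := ltnW jk.
    by rewrite t_nth // mulr_gt0.
  - move=> j; rewrite size_mkseq => jn; rewrite t_nth // /w /v /c -/q.
    case: ifP => _; split.
    + by rewrite ler01 lexx.
    + by rewrite invr_ge0 mulr_ge0 ?ltW // ltr_wpDl ?sqr_ge0.
    + rewrite expr1n mulVf // gt_eqF // mulr_gt0 // ltr_wpDl ?sqr_ge0 //.
    + by rewrite r_ge0 r_le1.
    + by rewrite divr_ge0 ?sqr_ge0 ?ltW.
    + by rewrite mulr1 divfK // gt_eqF.
  - by rewrite size_mkseq /w split_sum /r; field; rewrite gt_eqF.
apply: le_lt_trans phi_le_v _; rewrite /v split_sum.
have -> : d%:R * (q * (n%:R ^+ 2 + 1))^-1 + (n%:R - d%:R) * (r ^+ 2 / q) =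
   k%:R - d%:R + d%:R * (n%:R * (n%:R - d%:R) - (k%:R - d%:R) * (n%:R ^+ 2 + 1))
     / (k%:R * (n%:R - d%:R) * (n%:R ^+ 2 + 1)).
  rewrite /q /r; move: nd_gt0 n_gt0; rewrite nE => nd_gt0 n_gt0.
  by field; rewrite ?(addrC 1) !gt_eqF // ltr_wpDl ?sqr_ge0.
rewrite gtrDl pmulr_llt0 ?invr_gt0; last first.
  by rewrite !mulr_gt0 // ltr_wpDl ?sqr_ge0.
rewrite pmulr_rlt0; last by lra.
(* What remains is n (n - d) < (k - d) (n^2 + 1) with n = k + 1; it holds since n - d <= 2 (k - d)
   and 2n < n^2 + 1. *)
rewrite subr_lt0 nE; nra.
Qed.

Theorem theorem3 (R : realType) (d : nat) (d_gt0 : (0 < d)%N) :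
  (forall (n k : nat) (A : 'M[R]_(d, n)) (lambda : R),
     (d <= n)%N -> (0 < k)%N -> (k <= d)%N -> 0 < lambda ->
     exists z nu : R,
       [/\ is_min (subset_values k A lambda) z,
           is_min (relax_values k A lambda) nu,
           1 <= z / nu
         & z / nu <=
           if (k < d)%N
           then Num.min ((d%:R - 1) / (d%:R - k%:R)) (n%:R - k%:R + 1)
           else Num.min d%:R (n%:R - d%:R + 1)])
  /\
  (forall k : nat, (d + 1 <= k)%N ->
     exists (n : nat) (A : 'M[R]_(d, n)) (lambda nu : R),
       [/\ (k <= n)%N, 0 < lambda,
           is_min (relax_values k A lambda) nu
         & nu < 0]).
Proof.
split; first by move=> n k A lambda; apply: relax_ratio_bounds.
by move=> k; apply: relax_negative.
Qed.
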